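(* Let $(Q,L,D)$ be a nonholonomic system with symmetry $G$. A section $\xi\in\Gamma(\mathfrak g_S)$ is a horizontal gauge symmetry if and only if the $\mathcal M$-cotangent lift $\xi_Q^{\mathcal M}$ of the infinitesimal generator $\xi_Q$ leaves the Hamiltonian $\mathcal H_{\mathcal M}$ invariant, i.e. $\xi_Q^{\mathcal M}(\mathcal H_{\mathcal M})=0$. In this case, the associated horizontal gauge momentum is the first integral $\mathcal J_\xi:\mathcal M\to\mathbb R$ given by $$\mathcal J_\xi=\mathbf i_{\xi_Q^{\mathcal M}}\Theta_{\mathcal M}=\langle\mathcal J^{\mathrm{nh}},\xi\rangle.$$
   Context: All manifolds, distributions and maps are smooth; distributions are regular (constant rank); group actions are free and proper. Nonholonomic system. $(Q,L,D)$ consists of a manifold $Q$, a Lagrangian $L:TQ\to\mathbb R$ of mechanical type ($L=$ kinetic energy of a Riemannian metric $\kappa$ minus a potential on $Q$) and a (non-integrable) distribution $D\subset TQ$. Let $\kappa^\flat:TQ\to T^*Q$, $\kappa^\flat(X)(Y)=\kappa(X,Y)$. The constraint submanifold is the vector subbundle $\mathcal M=\kappa^\flat(D)\subset T^*Q$, with inclusion $\iota:\mathcal M\to T^*Q$ and projection $\tau_{\mathcal M}:\mathcal M\to Q$. $\mathcal H:T^*Q\to\mathbb R$ is the Hamiltonian associated to $L$, $\mathcal H_{\mathcal M}=\iota^*\mathcal H$. $\Theta_Q$ is the canonical 1-form on $T^*Q$, $\Omega_Q=-d\Theta_Q$, $\Theta_{\mathcal M}=\iota^*\Theta_Q$, $\Omega_{\mathcal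 M}=\iota^*\Omega_Q$. Set $\mathcal C_m=\{v\in T_m\mathcal M: T\tau_{\mathcal M}(v)\in D_{\tau_{\mathcal M}(m)}\}$. The restriction $\Omega_{\mathcal M}|_{\mathcal C}$ is nondegenerate, and the nonholonomic dynamics is the unique section $X_{\mathrm{nh}}$ of $\mathcal C$ with $\mathbf i_{X_{\mathrm{nh}}}\Omega_{\mathcal M}|_{\mathcal C}=d\mathcal H_{\mathcal M}|_{\mathcal C}$. A function $f\in C^\infty(\mathcal M)$ is a first integral if $X_{\mathrm{nh}}(f)=0$. Symmetry. A Lie group $G$ (Lie algebra $\mathfrak g$) acting on $Q$ is a symmetry if the tangent lifted action preserves $L$ and $D$; then the cotangent lifted action restricts to $\mathcal M$. $V\subset TQ$ is the distribution tangent to the $G$-orbits; $\eta_Q,\eta_{\mathcal M}$ are infinitesimal generators of $\eta\in\mathfrak g$ on $Q$ and $\mathcal M$. A section $\xi$ of the trivial bundle $\mathfrak g\times Q\to Q$ has generators $\xi_Q(q)=(\xi_q)_Q(q)$ and $\xi_{\mathcal M}(m)=(\xi_{\tau_{\mathcal M}(m)})_{\mathcal M}(m)$. Let $S=D\cap V$ and let $\mathfrak g_S\to Q$ be the subbundle of $\mathfrak g\times Q$ with fibers $\{\xi_q\in\mathfrak g:\ (\xi_q)_Q(q)\in S_q\}$. The nonholonomic momentum map $\mathcal J^{\mathrm{nh}}:\mathcal M\to\mathfrak g_S^*$ is given by $\langle\mathcal J^{\mathrm{nh}},\xi\rangle=\mathbf i_{\xi_{\mathcal M}}\Theta_{\mathcal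 M}$ for $\xi\in\Gamma(\mathfrak g_S)$. Lifts. For $X\in\mathfrak X(Q)$ let $X^{T^*Q}$ be its cotangent lift, i.e. the vector field on $T^*Q$ with $\mathbf i_{X^{T^*Q}}\Omega_Q=d\tilde X$, $\tilde X(\alpha)=\alpha(X)$. For $m\in\mathcal M$ one has $T_m(T^*Q)=\mathcal C_m\oplus\mathcal C_m^{\Omega}$, where $\mathcal C_m^\Omega$ is the $\Omega_Q$-orthogonal of $\mathcal C_m$ in $T_m(T^*Q)$; let $\mathcal T_{\mathcal C}(m)$ be the projection onto $\mathcal C_m$. For a section $\xi$ of $\mathfrak g\times Q\to Q$, the $\mathcal M$-cotangent lift of $\xi_Q$ is the vector field $\xi_Q^{\mathcal M}(m)=\mathcal T_{\mathcal C}(\xi_Q^{T^*Q})(m)$ on $\mathcal M$. Gauge symmetries. A horizontal gauge symmetry is a section $\xi\in\Gamma(\mathfrak g_S)$ such that $\xi_Q^{T^*Q}(\mathcal H)(m)=0$ for all $m\in\mathcal M$; its horizontal gauge momentum is the function $\mathcal J_\xi:=\iota^*\big(\mathbf i_{\xi_Q^{T^*Q}}\Theta_Q\big)$ on $\mathcal M$. *)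

(* Defs.v *)
From HB Require Import structures.
From mathcomp Require Import all_boot all_order all_algebra.
From mathcomp Require Import all_classical all_reals all_analysis.

Set Implicit Arguments.
Unset Strict Implicit.
Unset Printing Implicit Defensive.

Import Order.TTheory GRing.Theory Num.Theory.
Import numFieldNormedType.Exports.

Local Open Scope classical_set_scope.
Local Open Scope ring_scope.

(* ** Smooth functions between normed spaces *)

(* On an open subset of R^n, continuity of x |-> 'd f x v for each fixed v is
   continuity of the differential, so this is the usual C^k. *)
Fixpoint Ck (R : realType) (V W : normedModType R) (k : nat) (U : set V)
    (f : V -> W) : Prop :=
  if k is k'.+1 then
    (forall x, U x -> differentiable f x) /\
    (forall v, Ck k' U (fun x => 'd f x v))
  else forall x, U x -> {for x, continuous f}.

Definition smooth_on (R : realType) (V W : normedModType R) (U : set V)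
    (f : V -> W) : Prop :=
  forall k, Ck k U f.

(* The element satisfying P, for a P satisfied by exactly one vector. *)
Definition the (R : realType) (n : nat) (P : set 'rV[R]_n) : 'rV[R]_n :=
  xget 0 P.

(* Value of the covector p on the vector v, in dual coordinates. *)
Definition pair (R : realType) (n : nat) (p v : 'rV[R]_n) : R :=
  (p *m v^T) 0 0.

Definition covector (R : realType) (n : nat) (f : 'rV[R]_n -> R) : 'rV[R]_n :=
  \row_j f (delta_mx 0 j).

(* ** Manifolds *)

(* An atlas is given with a preferred chart [chart x] around each point x,
   defined on [chart_dom x] and with inverse [chart_inv x]. All atlas axioms
   are in [is_manifold]. The tangent space at x is identified with R^n through
   the preferred chart at x, so a tangent vector at any point of an
   n-dimensional manifold is an element of 'rV[R]_n. *)
Record atlas (R : realType) (n : nat) := Atlas {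
  point :> Type;
  chart_dom : point -> set point;
  chart : point -> point -> 'rV[R]_n;
  chart_inv : point -> 'rV[R]_n -> point }.

Section AtlasTopology.
Variables (R : realType) (n : nat) (A : atlas R n).

Definition atlas_open (U : set A) : Prop :=
  forall x, U x -> \forall y \near chart x x, U (chart_inv x y).

Lemma atlas_openT : atlas_open [set: A].
Proof. by move=> x _; near=> y. Unshelve. all: by end_near. Qed.

Lemma atlas_openI (U V : set A) :
  atlas_open U -> atlas_open V -> atlas_open (U `&` V).
Proof.
move=> hU hV x [Ux Vx]; near=> y.
by split; near: y; [exact: hU|exact: hV].
Unshelve. all: by end_near. Qed.

Lemma atlas_open_bigU (I : Type) (f : I -> set A) :
  (forall i, atlas_open (f i)) -> atlas_open (\bigcup_i f i).
Proof.
move=> hf x [i _ fix_]; near=> y; exists i => //.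
by near: y; exact: hf.
Unshelve. all: by end_near. Qed.

HB.instance Definition _ := gen_eqMixin (point A).
HB.instance Definition _ := gen_choiceMixin (point A).
HB.instance Definition _ := isOpenTopological.Build (point A)
  atlas_openT atlas_openI atlas_open_bigU.

Definition chart_ran (x : A) : set 'rV[R]_n := chart x @` chart_dom x.

Definition is_manifold : Prop :=
  [/\ [/\ forall x : A, chart_dom x x,
          forall x y : A, chart_dom x y -> chart_inv x (chart x y) = y,
          forall x y : A, open (chart x @` (chart_dom x `&` chart_dom y)) &
          forall x y : A, smooth_on (chart x @` (chart_dom x `&` chart_dom y))
                                    (chart y \o chart_inv x)],
      hausdorff_space A & @second_countable A].

(* Differential at y of the chart at x, and its inverse. *)
Definition dchart (x y : A) (v : 'rV[R]_n) : 'rV[R]_n :=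
  'd (chart x \o chart_inv y) (chart y y) v.

Definition dchart_inv (x y : A) (u : 'rV[R]_n) : 'rV[R]_n :=
  'd (chart y \o chart_inv x) (chart x y) u.

End AtlasTopology.

Record manifold (R : realType) (n : nat) := Manifold {
  manifold_atlas :> atlas R n;
  manifoldP : is_manifold manifold_atlas }.

Section Maps.
Variables (R : realType) (m n : nat) (A : atlas R m) (B : atlas R n).

Definition smooth_map (f : A -> B) : Prop :=
  forall x, exists U : set 'rV[R]_m,
    [/\ open U /\ U (chart x x), U `<=` chart_ran x,
        forall y, U y -> chart_dom (f x) (f (chart_inv x y)) &
        smooth_on U (chart (f x) \o f \o chart_inv x)].

Definition tmap (f : A -> B) (x : A) (v : 'rV[R]_m) : 'rV[R]_n :=
  'd (chart (f x) \o f \o chart_inv x) (chart x x) v.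

Definition embedding (f : A -> B) : Prop :=
  [/\ smooth_map f, injective f,
      forall x, injective (tmap f x) &
      forall U : set A, open U -> exists2 W : set B, open W & U = f @^-1` W].

Definition smooth_fun (W : normedModType R) (f : A -> W) : Prop :=
  forall x, smooth_on (chart_ran x) (f \o chart_inv x).

Definition dfun (f : A -> R) (x : A) (v : 'rV[R]_m) : R :=
  'd (f \o chart_inv x) (chart x x) v.

(* The product manifold. *)
Definition prod_atlas : atlas R (m + n) :=
  @Atlas R (m + n) (A * B)%type
    (fun x => chart_dom x.1 `*` chart_dom x.2)
    (fun x z => row_mx (chart x.1 z.1) (chart x.2 z.2))
    (fun x y => (chart_inv x.1 (lsubmx y), chart_inv x.2 (rsubmx y))).

Definition pullback1 (f : A -> B) (theta : B -> 'rV[R]_n -> R)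
    (x : A) (v : 'rV[R]_m) : R :=
  theta (f x) (tmap f x v).

Definition pullback2 (f : A -> B) (omega : B -> 'rV[R]_n -> 'rV[R]_n -> R)
    (x : A) (v w : 'rV[R]_m) : R :=
  omega (f x) (tmap f x v) (tmap f x w).

End Maps.

Section Fields.
Variables (R : realType) (n : nat) (A : atlas R n).

(* Components of a vector field in the chart at x. *)
Definition field_rep (X : A -> 'rV[R]_n) (x : A) (y : 'rV[R]_n) : 'rV[R]_n :=
  dchart x (chart_inv x y) (X (chart_inv x y)).

Definition smooth_field (X : A -> 'rV[R]_n) : Prop :=
  forall x, smooth_on (chart_ran x) (field_rep X x).

Definition lie_bracket (X Y : A -> 'rV[R]_n) (x : A) : 'rV[R]_n :=
  'd (field_rep Y x) (chart x x) (X x) - 'd (field_rep X x) (chart x x) (Y x).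

(* Value of the 1-form theta, in the chart at x, on the constant field u. *)
Definition form_rep (theta : A -> 'rV[R]_n -> R) (x : A) (u y : 'rV[R]_n) : R :=
  theta (chart_inv x y) (dchart_inv x (chart_inv x y) u).

(* d theta (u, v) = u(theta(v)) - v(theta(u)) for the constant fields u, v of
   the chart at x, whose bracket vanishes. *)
Definition ext_deriv (theta : A -> 'rV[R]_n -> R) (x : A) (u v : 'rV[R]_n) : R :=
  'd (form_rep theta x v) (chart x x) u - 'd (form_rep theta x u) (chart x x) v.

(* Smooth distributions of constant rank r. *)
Definition is_distribution (r : nat) (D : A -> {vspace 'rV[R]_n}) : Prop :=
  (forall x, \dim (D x) = r) /\
  (forall x, exists (U : set 'rV[R]_n) (F : 'I_r -> 'rV[R]_n -> 'rV[R]_n),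
    [/\ open U /\ U (chart x x), U `<=` chart_ran x,
        forall i, smooth_on U (F i) &
        forall y, U y -> D (chart_inv x y) =
          <<codom (fun i => dchart_inv x (chart_inv x y) (F i y))>>%VS]).

Definition is_section (D : A -> {vspace 'rV[R]_n}) (X : A -> 'rV[R]_n) : Prop :=
  smooth_field X /\ (forall x, X x \in D x).

Definition integrable (D : A -> {vspace 'rV[R]_n}) : Prop :=
  forall X Y, is_section D X -> is_section D Y ->
  forall x, lie_bracket X Y x \in D x.

(* kappa_x(v, w) for the metric with matrix K x in the preferred chart at x. *)
Definition metric_form (K : A -> 'M[R]_n) (x : A) (v w : 'rV[R]_n) : R :=
  (v *m K x *m w^T) 0 0.

Definition is_riemannian (K : A -> 'M[R]_n) : Prop :=
  [/\ forall x, (K x)^T = K x,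
      forall x v, v != 0 -> 0 < metric_form K x v v &
      forall x u v, smooth_on (chart_ran x) (fun y =>
        metric_form K (chart_inv x y) (dchart_inv x (chart_inv x y) u)
                                      (dchart_inv x (chart_inv x y) v))].

End Fields.

(* ** Cotangent bundle *)

Section Cotangent.
Variables (R : realType) (n : nat) (A : atlas R n).

(* A point of T*A is (q, p), with p the components of a covector at q in the
   preferred chart at q. Its charts are the (q, p) |-> (q^i, p_i) induced by
   the charts of A. *)
Definition cotangent : atlas R (n + n) :=
  @Atlas R (n + n) (A * 'rV[R]_n)%type
    (fun a => [set b | chart_dom a.1 b.1])
    (fun a b => row_mx (chart a.1 b.1)
       (covector (fun u => pair b.2 (dchart_inv a.1 b.1 u))))
    (fun a y => let q := chart_inv a.1 (lsubmx y) in
       (q, covector (fun v => pair (rsubmx y) (dchart a.1 q v)))).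

Definition cot_proj (a : cotangent) : A := a.1.

Definition Theta (a : cotangent) (v : 'rV[R]_(n + n)) : R :=
  pair a.2 (tmap cot_proj a v).

Definition Omega (a : cotangent) (v w : 'rV[R]_(n + n)) : R :=
  - ext_deriv Theta a v w.

Definition cot_lift (X : A -> 'rV[R]_n) (a : cotangent) : 'rV[R]_(n + n) :=
  the [set v | forall w,
    Omega a v w = dfun (fun b : cotangent => pair b.2 (X b.1)) a w].

End Cotangent.

(* ** Lie groups and actions *)

(* The Lie algebra is the tangent space 'rV[R]_k at the unit. *)
Record lie_group (R : realType) (k : nat) := LieGroup {
  lie_manifold :> manifold R k;
  lmul : lie_manifold -> lie_manifold -> lie_manifold;
  lone : lie_manifold;
  linv : lie_manifold -> lie_manifold;
  lmulA : forall x y z, lmul x (lmul y z) = lmul (lmul x y) z;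
  lmul1 : forall x, lmul lone x = x;
  lmulV : forall x, lmul (linv x) x = lone;
  lmul_smooth : smooth_map
    (fun z : prod_atlas lie_manifold lie_manifold => lmul z.1 z.2);
  linv_smooth : smooth_map linv }.

Section Actions.
Variables (R : realType) (k n : nat) (G : lie_group R k).

(* Infinitesimal generator of eta at x, for an action on A. *)
Definition generator (A : atlas R n) (act : G -> A -> A) (eta : 'rV[R]_k)
    (x : A) : 'rV[R]_n :=
  tmap (fun g : G => act g x) (lone G) eta.

Variables (Q : manifold R n) (act : G -> Q -> Q).

Definition free_proper_action : Prop :=
  [/\ (forall q, act (lone G) q = q) /\
      (forall g h q, act (lmul g h) q = act g (act h q)),
      smooth_map (fun z : prod_atlas G Q => act z.1 z.2),
      forall g q, act g q = q -> g = lone G &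
      forall K : set (prod_atlas Q Q), compact K ->
        compact ((fun z : prod_atlas G Q =>
                    (act z.1 z.2, z.2) : prod_atlas Q Q) @^-1` K)].

(* (g . p)(v) = p(T g^-1 (v)) *)
Definition cot_act (g : G) (a : cotangent Q) : cotangent Q :=
  (act g a.1, covector (fun v => pair a.2 (tmap (act (linv g)) (act g a.1) v))).

(* The distribution V tangent to the orbits. *)
Definition vertical (q : Q) : {vspace 'rV[R]_n} :=
  limg (linfun (fun eta => generator act eta q)).

Definition section_generator (xi : Q -> 'rV[R]_k) (q : Q) : 'rV[R]_n :=
  generator act (xi q) q.

End Actions.

(* ** Nonholonomic systems *)

Record nonholonomic_system (R : realType) (n r : nat) (Q : manifold R n) :=
  NonholonomicSystem {
    metric : Q -> 'M[R]_n;
    potential : Q -> R;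
    constr : Q -> {vspace 'rV[R]_n};
    metricP : is_riemannian metric;
    potentialP : smooth_fun potential;
    constrP : is_distribution r constr;
    constr_nonint : ~ integrable constr }.

Section System.
Variables (R : realType) (n r : nat) (Q : manifold R n)
  (N : nonholonomic_system r Q).

Definition lagrangian (q : Q) (v : 'rV[R]_n) : R :=
  metric_form (metric N) q v v / 2 - potential N q.

(* Components of the covector kappa(v, -). *)
Definition flat (q : Q) (v : 'rV[R]_n) : 'rV[R]_n := v *m metric N q.

(* Legendre transform of the Lagrangian, whose fibre derivative is [flat]. *)
Definition hamiltonian (a : cotangent Q) : R :=
  let v := a.2 *m invmx (metric N a.1) in pair a.2 v - lagrangian a.1 v.

(* A manifold with an embedding in T*Q with image kappa^flat(D). *)
Definition is_constraint_submanifold (M : manifold R (n + r))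
    (iota : M -> cotangent Q) : Prop :=
  embedding iota /\
  range iota = [set a | exists2 v, v \in constr N a.1 & a.2 = flat a.1 v].

Variables (M : manifold R (n + r)) (iota : M -> cotangent Q).

Definition tauM (m : M) : Q := cot_proj (iota m).
Definition HM (m : M) : R := hamiltonian (iota m).
Definition ThetaM : M -> 'rV[R]_(n + r) -> R := pullback1 iota (@Theta R n Q).
Definition OmegaM : M -> 'rV[R]_(n + r) -> 'rV[R]_(n + r) -> R :=
  pullback2 iota (@Omega R n Q).

(* The distribution C on M. *)
Definition CM (m : M) : set 'rV[R]_(n + r) :=
  [set v | tmap tauM m v \in constr N (tauM m)].

Definition Xnh (m : M) : 'rV[R]_(n + r) :=
  the [set v | CM m v /\ forall w, CM m w -> OmegaM m v w = dfun HM m w].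

Definition first_integral (f : M -> R) : Prop :=
  smooth_fun f /\ forall m, dfun f m (Xnh m) = 0.

(* The component in C, viewed in T_m M, of a vector v of T_m(T*Q) along the
   decomposition T_m(T*Q) = C_m (+) C_m^Omega. *)
Definition projC (m : M) (v : 'rV[R]_(n + n)) : 'rV[R]_(n + r) :=
  the [set u | CM m u /\
    forall w, CM m w -> Omega (iota m) (v - tmap iota m u) (tmap iota m w) = 0].

Variables (k : nat) (G : lie_group R k) (act : G -> Q -> Q).

Definition is_symmetry : Prop :=
  [/\ free_proper_action act,
      forall g q v, lagrangian (act g q) (tmap (act g) q v) = lagrangian q v &
      forall g q, (linfun (tmap (act g) q) @: constr N q)%VS =
                  constr N (act g q)].

Definition distrS (q : Q) : {vspace 'rV[R]_n} :=
  (constr N q :&: vertical act q)%VS.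

(* The restriction to M of the cotangent lifted action. *)
Definition actM (g : G) (m : M) : M :=
  xget m [set m' | iota m' = cot_act act g (iota m)].

Definition gS (q : Q) : set 'rV[R]_k :=
  [set eta | generator act eta q \in distrS q].

Definition is_section_gS (xi : Q -> 'rV[R]_k) : Prop :=
  smooth_fun xi /\ forall q, gS q (xi q).

(* The value at eta, an element of the fibre of g_S, of the linear form
   J^nh(m). *)
Definition Jnh (m : M) (eta : 'rV[R]_k) : R :=
  ThetaM m (generator actM eta m).

(* xi_Q^{T*Q} *)
Definition section_cot_lift (xi : Q -> 'rV[R]_k) :
    cotangent Q -> 'rV[R]_(n + n) :=
  cot_lift (section_generator act xi).

(* xi_Q^M *)
Definition section_M_lift (xi : Q -> 'rV[R]_k) (m : M) : 'rV[R]_(n + r) :=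
  projC m (section_cot_lift xi (iota m)).

Definition horizontal_gauge_symmetry (xi : Q -> 'rV[R]_k) : Prop :=
  is_section_gS xi /\
  forall m, dfun hamiltonian (iota m) (section_cot_lift xi (iota m)) = 0.

Definition gauge_momentum (xi : Q -> 'rV[R]_k) (m : M) : R :=
  Theta (iota m) (section_cot_lift xi (iota m)).

End System.

(* Main.v *)
From HB Require Import structures.
Require Import Defs.
From mathcomp Require Import all_boot all_order all_algebra.
From mathcomp Require Import all_classical all_reals all_analysis.
From mathcomp Require Import ring lra.
Import GRing.Theory numFieldNormedType.Exports.
Local Open Scope classical_set_scope.
Local Open Scope ring_scope.

(* Write J_xi(q, p) = p(xi_Q(q)), so that the cotangent lift Y of xi_Q is given by
   i_Y Omega = dJ_xi and projects onto xi_Q, a section of D. In induced charts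
   Omega is the constant canonical form. The tangent space of M contains
   0 x kappa^flat(D) and projects onto TQ: this follows by lifting explicit curves
   of kappa^flat(D) through the embedding, since a continuous lift of a
   differentiable map through an immersion is differentiable. Testing
   Omega-orthogonality to C against 0 x kappa^flat(D) and then against all of C,
   the projection onto C changes a vector over D by some (0, g) with g vanishing
   on D. At a point (q, kappa^flat(v)) of M one has dH(0, g) = g(v) = 0, whence
   dH_M(xi_Q^M) = dH(Y); and dJ_xi(X_nh) = Omega(Y, X_nh) = - dH_M(xi_Q^M).
   Since (0, g) is vertical, Theta takes the same value on Y and xi_Q^M; this value
   is <J^nh, xi> because the orbit map of G on M is the lift through the embedding
   of the smooth orbit map of G on T*Q. *)

Set Implicit Arguments.
Unset Strict Implicit.
Unset Printing Implicit Defensive.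
Import Order.TTheory Num.Theory.

(** * Differentials *)

(** Tangent vectors at a point are read in that point's own preferred chart, and these charts need
    not vary continuously. Smoothness of a field, of the metric or of a lifted action is therefore
    not visible in pointwise values: each object is first moved to the chart at one fixed point,
    where it becomes an expression in a single smooth function and its partial derivatives.

    [M] is known only through [iota], and none of its charts is adapted to the constraint. Its
    tangent vectors are obtained from maps into [T*Q] with values in the image; continuity of their
    lifts is the topological half of [embedding].

    [cot_lift], [projC], [actM] and [Xnh] are chosen elements with a default value. For the first
    three the defining property must be shown attainable before it can be used. For [projC] this is
    done on vectors over [D], where it reduces to representing a covector on [D] by a vector of [D]
    through the metric. *)

Section Differentials.
Variable R : realType.
Implicit Types V W Z : normedModType R.

(** Unfolds the little-o into an explicit estimate; differentiability of a lift is proved from this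
    estimate by hand. *)
Lemma diff_estimateP V W (f : V -> W) x (L : {linear V -> W}) :
  continuous L ->
  (is_diff x f L <-> forall e : R, 0 < e ->
    \forall h \near 0, `|f (h + x) - f x - L h| <= e * `|h|).
Proof.
move=> cL; split=> [[df dE] | H].
  have /eqaddoP H := diff_locally df.
  move=> e e0; have := H e e0; apply: filterS => h /=.
  by rewrite -dE !fctE opprD addrA.
have E : f \o shift x = cst (f x) + L +o_ 0 id.
  apply/eqaddoP => e e0; have := H e e0; apply: filterS => h /=.
  by rewrite !fctE opprD addrA.
have dE := diff_unique cL E.
by apply: DiffDef => //; apply/diff_locallyP; rewrite dE.
Qed.

Lemma diff_estimate V W (f : V -> W) x : differentiable f x ->
  forall e : R, 0 < e ->
    \forall h \near 0, `|f (h + x) - f x - 'd f x h| <= e * `|h|.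
Proof.
move=> df; apply/diff_estimateP; first exact: diff_continuous.
exact: differentiableP.
Qed.

Lemma near_is_diff V W (f g : V -> W) x (L : {linear V -> W}) :
  {near x, f =1 g} -> is_diff x f L -> is_diff x g L.
Proof.
move=> fg dfL; have cL : continuous L.
  by rewrite -(@diff_val _ _ _ _ _ _ _ dfL); apply: diff_continuous; case: dfL.
have fgx := nbhs_singleton fg.
apply/(diff_estimateP _ _ cL) => e e0.
have /(diff_estimateP _ _ cL) /(_ e e0) H := dfL.
have fg0 : \forall h \near 0, f (h + x) = g (h + x).
  have : \forall y \near x, f y = g y by [].
  by rewrite (near_shift 0 x) subr0.
near=> h; rewrite -fgx -(near fg0 h) //; near: h; exact: H.
Unshelve. all: by end_near. Qed.

Lemma diff_apply V W (f df : V -> W) x v : is_diff x f df -> 'd f x v = df v.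
Proof. by case=> _ ->. Qed.

Lemma near_differentiable V W (f g : V -> W) x :
  {near x, f =1 g} -> differentiable f x -> differentiable g x.
Proof.
by move=> fg /differentiableP /(near_is_diff fg) H; exact: ex_diff.
Qed.

Lemma near_diff V W (f g : V -> W) x v :
  {near x, f =1 g} -> differentiable f x -> 'd g x v = 'd f x v.
Proof.
by move=> fg /differentiableP /(near_is_diff fg) H; rewrite diff_val.
Qed.

End Differentials.

(** * Linear maps and coordinates on row vectors *)

Section RowVectors.
Variable R : realType.
Implicit Types V W : normedModType R.

Lemma linear_rV_sum p (W : lmodType R) (f : {linear 'rV[R]_p -> W}) v :
  f v = \sum_j v 0 j *: f (delta_mx 0 j).
Proof.
by rewrite [in LHS](row_sum_delta v) linear_sum; apply: eq_bigr => j _; rewrite linearZ.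
Qed.

Lemma linear_rV_continuous p W (f : {linear 'rV[R]_p -> W}) : continuous f.
Proof.
have -> : (f : _ -> _) = fun v => \sum_j v 0 j *: f (delta_mx 0 j).
  by apply/funext => v; exact: linear_rV_sum.
move=> x; apply: (@cvg_big _ _ _ _ xpredT _ _ (nbhs x)) => [|j _].
  exact: add_continuous.
by apply: cvgZr_tmp; exact: coord_continuous.
Qed.

Lemma is_diff_linear p W (f : {linear 'rV[R]_p -> W}) x : is_diff x f f.
Proof.
have cf := @linear_rV_continuous p W f.
by apply: DiffDef; [exact: linear_differentiable|rewrite diff_lin].
Qed.

Lemma differentiable_rV p V (f : V -> 'rV[R]_p) x :
  (forall j, differentiable (fun y => f y 0 j : R) x) -> differentiable f x.
Proof.
move=> df; have -> : f = \sum_j (fun y => f y 0 j *: delta_mx 0 j).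
  by apply/funext => y; rewrite fct_sumE [LHS]row_sum_delta.
by apply: differentiable_sum => j; apply: differentiableZl.
Qed.

Lemma diff_linear_comp p V W (L : {linear 'rV[R]_p -> W}) (f : V -> 'rV[R]_p) x v :
  differentiable f x -> 'd (L \o f) x v = L ('d f x v).
Proof.
have dL := is_diff_linear L (f x).
by move=> df; rewrite diff_comp//= diff_val.
Qed.

Lemma differentiable_linear_comp p V W (L : {linear 'rV[R]_p -> W}) (f : V ->
  'rV[R]_p) x :
  differentiable f x -> differentiable (L \o f) x.
Proof.
have dL := is_diff_linear L (f x).
by move=> df; apply: differentiable_comp.
Qed.

(** The coordinate form as a named linear map, so that the rules for composition with linear maps
    apply to coordinates. *)
Definition coordl p (j : 'I_p) (v : 'rV[R]_p) : R := v 0 j.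

Lemma coordl_is_linear p j : linear (@coordl p j).
Proof. by move=> a u v; rewrite /coordl !mxE. Qed.
HB.instance Definition _ p j :=
  GRing.isLinear.Build R 'rV[R]_p R _ (@coordl p j) (@coordl_is_linear p j).

Lemma diff_rV p V (f : V -> 'rV[R]_p) x v j : differentiable f x ->
  ('d f x v) 0 j = 'd (fun y => f y 0 j : R) x v.
Proof. by move=> df; exact: esym (diff_linear_comp (coordl j) v df). Qed.

Lemma differentiable_rV_coord p V (f : V -> 'rV[R]_p) x j : differentiable f x ->
  differentiable (fun y => f y 0 j : R) x.
Proof. exact: (differentiable_linear_comp (coordl j)). Qed.

End RowVectors.

(** * Smooth functions *)

Section Smoothness.
Variable R : realType.
Implicit Types V W : normedModType R.

Lemma open_near (T : topologicalType) (U P : set T) x :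
  open U -> U x -> (forall y, U y -> P y) -> \forall y \near x, P y.
Proof. by move=> oU Ux H; apply: filterS H _; exact: open_nbhs_nbhs. Qed.

Lemma Ck_eq V W k (U : set V) (f g : V -> W) :
  open U -> (forall x, U x -> f x = g x) -> Ck k U f -> Ck k U g.
Proof.
move=> oU; elim: k f g => [|k IH] f g fg /=.
  move=> cf x Ux; suff : g @ x --> f x by rewrite (fg x Ux).
  have cfx : f @ x --> f x := cf x Ux; move: cfx.
  apply: cvg_trans; apply: near_eq_cvg.
  by apply: (open_near oU) => // y /fg.
have nfg x : U x -> {near x, f =1 g}.
  by move=> Ux; apply: (open_near oU).
move=> [df Cf]; split=> [x Ux|v]; first by apply: near_differentiable (df x Ux);
  exact: nfg.
by apply: IH (Cf v) => x Ux; rewrite (near_diff _ (nfg x Ux))//; exact: df.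
Qed.

Lemma Ck_sub V W k (U U' : set V) (f : V -> W) : U' `<=` U -> Ck k U f -> Ck k U' f.
Proof.
move=> UU'; elim: k f => [|k IH] f /=; first by move=> cf x /UU'; exact: cf.
by move=> [df Cf]; split=> [x /UU'/df//|v]; exact: IH.
Qed.

Lemma CkW V W k (U : set V) (f : V -> W) : Ck k.+1 U f -> Ck k U f.
Proof.
elim: k f => [|k IH] f; last by move=> [df Cf]; split=> // v; apply: IH; exact: Cf.
by move=> [df _] x Ux; apply: differentiable_continuous; exact: df.
Qed.

(** [Ck] is a condition at each point of the set, with differentials taken in the whole space, so it
    can be checked on any family of sets that covers. *)
Lemma Ck_local V W k (U : set V) (f : V -> W) :
  (forall x, U x -> exists2 U' : set V, U' x & Ck k U' f) -> Ck k U f.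
Proof.
elim: k f => [|k IH] f H.
  by move=> x /H[U' U'x cf]; exact: cf.
split=> [x /H[U' U'x [df _]]|v]; first exact: df.
by apply: IH => x /H[U' U'x [_ Cf]]; exists U' => //; exact: Cf.
Qed.

Lemma Ck_cst V W k (U : set V) (c : W) : Ck k U (cst c).
Proof.
elim: k c => [|k IH] c; first by move=> x _; exact: cvg_cst.
split=> [x _|v]; first exact: differentiable_cst.
have -> : (fun x => 'd (cst c : V -> W) x v) = cst 0 by apply/funext => x;
  rewrite diff_cst.
exact: IH.
Qed.

Lemma Ck_linear p W k (U : set 'rV[R]_p) (f : {linear 'rV[R]_p -> W}) : Ck k U f.
Proof.
case: k => [|k]; first by move=> x _; exact: linear_rV_continuous.
split=> [x _|v]; first by case: (is_diff_linear f x).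
have -> : (fun x => 'd f x v) = cst (f v).
  by apply/funext => x; have df := is_diff_linear f x; rewrite diff_val.
exact: Ck_cst.
Qed.

Lemma CkD V W k (U : set V) (f g : V -> W) : open U ->
  Ck k U f -> Ck k U g -> Ck k U (f \+ g).
Proof.
move=> oU; elim: k f g => [|k IH] f g Cf Cg.
  by move=> x Ux; apply: cvgD; [exact: Cf|exact: Cg].
case: Cf Cg => df Cf [dg Cg].
split=> [x Ux|v]; first by apply: differentiableD; [exact: df|exact: dg].
apply: Ck_eq (IH _ _ (Cf v) (Cg v)) => // x Ux /=.
by rewrite [RHS](congr1 (fun h => h v) (diffD (df x Ux) (dg x Ux))).
Qed.

Lemma CkM V k (U : set V) (f g : V -> R) : open U ->
  Ck k U f -> Ck k U g -> Ck k U (f \* g).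
Proof.
move=> oU; elim: k f g => [|k IH] f g Cf Cg.
  by move=> x Ux; apply: cvgM; [exact: Cf|exact: Cg].
have Cf' := CkW Cf; have Cg' := CkW Cg.
case: Cf Cg => df Cf [dg Cg].
split=> [x Ux|v]; first by apply: differentiableM; [exact: df|exact: dg].
apply: Ck_eq (CkD oU (IH _ _ Cf' (Cg v)) (IH _ _ Cg' (Cf v))) => // x Ux /=.
by rewrite [RHS](congr1 (fun h => h v) (diffM (df x Ux) (dg x Ux))).
Qed.

Lemma Ck_sum V W k (U : set V) (I : Type) (r : seq I) (f : I -> V -> W) : open U ->
  (forall i, Ck k U (f i)) -> Ck k U (fun x => \sum_(i <- r) f i x).
Proof.
move=> oU Cf; elim: r => [|i r IH].
  by apply: Ck_eq (Ck_cst k U 0) => // x _; rewrite big_nil.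
by apply: Ck_eq (CkD oU (Cf i) IH) => // x _; rewrite big_cons.
Qed.

Lemma Ck_scale V W k (U : set V) (f : V -> R) (w : W) : open U ->
  Ck k U f -> Ck k U (fun x => f x *: w).
Proof.
move=> oU; elim: k f => [|k IH] f Cf.
  by move=> x Ux; apply: cvgZr_tmp; exact: Cf.
case: Cf => df Cf; split=> [x Ux|v]; first by apply: differentiableZl; exact: df.
apply: Ck_eq (IH _ (Cf v)) => // x Ux /=.
by rewrite [RHS](congr1 (fun h => h v) (diffZl w (df x Ux))).
Qed.

Lemma Ck_rV V p k (U : set V) (f : V -> 'rV[R]_p) : open U ->
  (forall j, Ck k U (fun x => f x 0 j : R)) -> Ck k U f.
Proof.
move=> oU Cf; apply: Ck_eq (Ck_sum (index_enum _) oU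
  (fun j => Ck_scale (delta_mx 0 j) oU (Cf j))) => // x _.
by rewrite -row_sum_delta.
Qed.

Lemma Ck_linear_comp V p W k (U : set V) (L : {linear 'rV[R]_p -> W}) (f : V ->
  'rV[R]_p) : open U ->
  Ck k U f -> Ck k U (L \o f).
Proof.
move=> oU; elim: k f => [|k IH] f Cf.
  move=> x Ux; apply: continuous_comp; first exact: Cf.
  exact: linear_rV_continuous.
case: Cf => df Cf; split=> [x Ux|v].
  by apply: differentiable_linear_comp; exact: df.
apply: Ck_eq (IH _ (Cf v)) => // x Ux /=.
by rewrite diff_linear_comp//; exact: df.
Qed.

Lemma Ck_coord V p k (U : set V) (f : V -> 'rV[R]_p) j : open U ->
  Ck k U f -> Ck k U (fun x => f x 0 j : R).
Proof. by move=> oU; exact: (Ck_linear_comp (coordl j)). Qed.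

(** Induction through [d(g o f)(v) = \sum_j (df v)_j (d_j g o f)]. Real values of [g] keep these
    products scalar; vector values then follow coordinate by coordinate. *)
Lemma Ck_comp_real V p k (U : set V) (U' : set 'rV[R]_p) (f : V -> 'rV[R]_p)
    (g : 'rV[R]_p -> R) :
  open U -> (forall x, U x -> U' (f x)) ->
  Ck k U f -> Ck k U' g -> Ck k U (g \o f).
Proof.
move=> oU fU; elim: k f g fU => [|k IH] f g fU Cf Cg.
  by move=> x Ux; apply: continuous_comp; [exact: Cf|apply: Cg; exact: fU].
have Cf' := CkW Cf.
case: Cf Cg => df Cf [dg Cg]; split=> [x Ux|v].
  by apply: differentiable_comp; [exact: df|apply: dg; exact: fU].
have H j : Ck k U ((fun x => ('d f x v) 0 j :
  R) \* ((fun y => 'd g y (delta_mx 0 j)) \o f)).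
  by apply: CkM => //; [exact: (Ck_coord j oU (Cf v))|apply: IH => //; exact: Cg].
apply: Ck_eq (Ck_sum (index_enum _) oU H) => // x Ux /=.
rewrite (diff_comp (df x Ux) (dg _ (fU x Ux)))/=.
by rewrite [RHS]linear_rV_sum.
Qed.

Lemma Ck_comp V p q k (U : set V) (U' : set 'rV[R]_p) (f : V -> 'rV[R]_p)
    (g : 'rV[R]_p -> 'rV[R]_q) :
  open U -> open U' -> (forall x, U x -> U' (f x)) ->
  Ck k U f -> Ck k U' g -> Ck k U (g \o f).
Proof.
move=> oU oU' fU Cf Cg; apply: Ck_rV => // j.
by apply: (Ck_comp_real oU fU Cf (g := fun y => g y 0 j)); exact: Ck_coord.
Qed.

Lemma smooth_on_open V W (U : set V) (f : V -> W) x : smooth_on U f -> U x ->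
  differentiable f x.
Proof. by move=> /(_ 1%N)[df _] /df. Qed.

End Smoothness.

(** * The pairing of covectors with vectors *)

Section Pairing.
Variables (R : realType) (n : nat).
Implicit Types (p v : 'rV[R]_n).

Lemma pairE p v : pair p v = \sum_j p 0 j * v 0 j.
Proof. by rewrite /pair mxE; apply: eq_bigr => j _; rewrite !mxE. Qed.

Lemma pairC p v : pair p v = pair v p.
Proof. by rewrite !pairE; apply: eq_bigr => j _; rewrite mulrC. Qed.

Lemma pair_is_linear p : linear (pair p).
Proof.
move=> a u v; rewrite !pairE scaler_sumr -big_split; apply: eq_bigr => j _.
by rewrite !mxE mulrDr mulrCA.
Qed.
HB.instance Definition _ p :=
  GRing.isLinear.Build R 'rV[R]_n R _ (pair p) (pair_is_linear p).

Lemma pairDl p q v : pair (p + q) v = pair p v + pair q v.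
Proof. by rewrite pairC linearD /= !(pairC v). Qed.

Lemma pairNl p v : pair (- p) v = - pair p v.
Proof. by rewrite pairC linearN /= (pairC v). Qed.

Lemma pair0l v : pair 0 v = 0.
Proof. by rewrite pairC linear0. Qed.

Lemma pair_delta p j : pair p (delta_mx 0 j) = p 0 j.
Proof.
rewrite pairE (bigD1 j)//= big1 ?addr0 ?mxE ?eqxx ?mulr1// => i /negPf ij.
by rewrite mxE ij andbF mulr0.
Qed.

Lemma pair_ext p q : (forall v, pair p v = pair q v) -> p = q.
Proof. by move=> H; apply/rowP => j; rewrite -!pair_delta. Qed.

Lemma covectorK (f : {linear 'rV[R]_n -> R}) v : pair (covector f) v = f v.
Proof. by rewrite [RHS]linear_rV_sum pairE; apply: eq_bigr => j _;
  rewrite mxE mulrC. Qed.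

End Pairing.

(** * Differentiability of products, matrix inverses and lifts *)

Section Products.
Variables (R : realType) (V : normedModType R).

Lemma differentiable_bigsum (I : Type) (r : seq I) (f : I -> V -> R) x :
  (forall i, differentiable (f i) x) -> differentiable (fun y => \sum_(i <- r) f i y) x.
Proof.
move=> df; elim: r => [|i r IH].
  have -> : (fun y => \sum_(i <- [::]) f i y) = cst 0 by apply/funext => y;
    rewrite big_nil.
  exact: differentiable_cst.
have -> : (fun y => \sum_(j <- i :: r) f j y) = f i + (fun y => \sum_(j <- r) f j y).
  by apply/funext => y; rewrite big_cons.
exact: differentiableD.
Qed.

Lemma differentiable_bigprod (I : Type) (r : seq I) (f : I -> V -> R) x :
  (forall i, differentiable (f i) x) ->
    differentiable (fun y => \prod_(i <- r) f i y) x.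
Proof.
move=> df; elim: r => [|i r IH].
  have -> : (fun y => \prod_(i <- [::]) f i y) = cst 1 by apply/funext => y;
    rewrite big_nil.
  exact: differentiable_cst.
have -> : (fun y => \prod_(j <- i :: r) f j y) = f i * (fun y => \prod_(j <- r) f j y).
  by apply/funext => y; rewrite big_cons.
exact: differentiableM.
Qed.

Lemma differentiable_pair n (f g : V -> 'rV[R]_n) x :
  differentiable f x -> differentiable g x ->
    differentiable (fun y => pair (f y) (g y)) x.
Proof.
move=> df dg; have -> : (fun y => pair (f y) (g y)) = fun y => \sum_j f y 0 j * g y 0 j.
  by apply/funext => y; rewrite pairE.
apply: differentiable_bigsum => j.
by apply: (@differentiableM _ _ (fun y => f y 0 j : R) (fun y => g y 0 j : R));
  exact: differentiable_rV_coord.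
Qed.

Lemma is_diff_bigsum (I : Type) (r : seq I) (f df : I -> V -> R) x :
  (forall i, is_diff x (f i) (df i)) ->
  is_diff x (fun y => \sum_(i <- r) f i y) (fun v => \sum_(i <- r) df i v).
Proof.
move=> dfP; elim: r => [|i r IH].
  have -> : (fun y => \sum_(i <- [::]) f i y) = cst 0 by apply/funext => y;
    rewrite big_nil.
  have -> : (fun y => \sum_(i <- [::]) df i y) = 0 by apply/funext => y;
    rewrite big_nil.
  exact: is_diff_cst.
have -> : (fun y => \sum_(j <- i :: r) f j y) = f i + (fun y => \sum_(j <- r) f j y).
  by apply/funext => y; rewrite big_cons.
have -> : (fun y => \sum_(j <- i :: r) df j y) = df i + (fun y => \sum_(j <- r) df j y).
  by apply/funext => y; rewrite big_cons.
exact: is_diffD.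
Qed.

Lemma is_diff_pair_rV n (f g df dg : V -> 'rV[R]_n) x :
  is_diff x f df -> is_diff x g dg ->
  is_diff x (fun y => pair (f y) (g y))
    (fun v => pair (df v) (g x) + pair (f x) (dg v)).
Proof.
move=> dfP dgP.
have C h dh j : is_diff x h dh -> is_diff x (coordl j \o h) (coordl j \o dh).
  by move=> hP; apply: (is_diff_comp hP); exact: is_diff_linear.
have := @is_diff_bigsum _ (index_enum 'I_n) _ _ x
  (fun j => is_diffM (C n _ _ j dfP) (C n _ _ j dgP)).
have -> : (fun y => \sum_(j < n) ((coordl j \o f) * (coordl j \o g)) y) =
  (fun y => pair (f y) (g y)).
  by apply/funext => y; rewrite pairE.
congr is_diff_def; apply/funext => v; rewrite !pairE -big_split; apply: eq_bigr => j _.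
by rewrite !fctE /coordl /= addrC mulrC.
Qed.

Lemma differentiable_det n (A : V -> 'M[R]_n) x :
  (forall i j, differentiable (fun y => A y i j : R) x) ->
    differentiable (fun y => \det (A y)) x.
Proof.
move=> dA; apply: differentiable_bigsum => s.
apply: (@differentiableZ _ _ _ (fun y => \prod_i A y i _)).
exact: differentiable_bigprod.
Qed.

Lemma differentiable_invmx n (A : V -> 'M[R]_n) x :
  (\forall y \near x, A y \in unitmx) ->
  (forall i j, differentiable (fun y => A y i j : R) x) ->
  forall i j, differentiable (fun y => invmx (A y) i j : R) x.
Proof.
move=> uA dA i j.
(* Cramer's formula, which agrees with [invmx] only where the matrix is invertible; hence the
   hypothesis near [x]. *)
apply: (@near_differentiable _ _ _ (fun y => (\det (A y))^-1 * cofactor (A y) j i)).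
  by apply: filterS uA => y uy; rewrite /invmx uy !mxE.
apply: (@differentiableM _ _ (fun y => (\det (A y))^-1) (fun y => cofactor (A y) j i)).
  apply: differentiableV; first exact: differentiable_det.
  by have := nbhs_singleton uA; rewrite unitmxE unitfE.
apply: (@differentiableM _ _ (cst _) (fun y => \det (row' j (col' i (A y)))));
  first exact: differentiable_cst.
apply: differentiable_det => a b.
have -> : (fun y => row' j (col' i (A y)) a b : R) = fun y => A y (lift j a) (lift i b).
  by apply/funext => y; rewrite !mxE.
exact: dA.
Qed.

Lemma differentiable_mulmx n m (f : V -> 'rV[R]_n) (A : V -> 'M[R]_(n, m)) x :
  differentiable f x -> (forall i j, differentiable (fun y => A y i j : R) x) ->
  differentiable (fun y => f y *m A y) x.
Proof.
move=> df dA; apply: differentiable_rV => j.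
have -> : (fun y => (f y *m A y) 0 j : R) = fun y => \sum_i f y 0 i * A y i j.
  by apply/funext => y; rewrite mxE.
apply: differentiable_bigsum => i.
by apply: (@differentiableM _ _ (fun y => f y 0 i : R) (fun y => A y i j)) => //;
  exact: differentiable_rV_coord.
Qed.

Lemma Ck_pair n k (U : set V) (f g : V -> 'rV[R]_n) : open U ->
  Ck k U f -> Ck k U g -> Ck k U (fun y => pair (f y) (g y)).
Proof.
move=> oU Cf Cg.
have H j : Ck k U ((fun x => f x 0 j : R) \* (fun y => g y 0 j : R))
  by apply: CkM => //; exact: Ck_coord.
by apply: Ck_eq (Ck_sum (index_enum _) oU H) => // y _; rewrite pairE.
Qed.

Lemma differentiable_row_mx n m (f : V -> 'rV[R]_n) (g : V -> 'rV[R]_m) x :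
  differentiable f x -> differentiable g x ->
    differentiable (fun y => row_mx (f y) (g y)) x.
Proof.
move=> df dg; apply: differentiable_rV => j; case: (split_ordP j) => i ->.
  have -> : (fun y => row_mx (f y) (g y) 0 (lshift m i)) = fun y => f y 0 i
    by apply/funext => y; rewrite row_mxEl.
  exact: differentiable_rV_coord.
have -> : (fun y => row_mx (f y) (g y) 0 (rshift n i)) = fun y => g y 0 i
  by apply/funext => y; rewrite row_mxEr.
exact: differentiable_rV_coord.
Qed.

Lemma Ck_row_mx n m k (U : set V) (f : V -> 'rV[R]_n) (g : V -> 'rV[R]_m) : open U ->
  Ck k U f -> Ck k U g -> Ck k U (fun y => row_mx (f y) (g y)).
Proof.
move=> oU Cf Cg; apply: Ck_rV => // j; case: (split_ordP j) => i ->.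
  by apply: Ck_eq (Ck_coord i oU Cf) => // y _; rewrite row_mxEl.
by apply: Ck_eq (Ck_coord i oU Cg) => // y _; rewrite row_mxEr.
Qed.

Lemma diff_row_mx n m (f : V -> 'rV[R]_n) (g : V -> 'rV[R]_m) x v :
  differentiable f x -> differentiable g x ->
  'd (fun y => row_mx (f y) (g y)) x v = row_mx ('d f x v) ('d g x v).
Proof.
move=> df dg; have dfg := differentiable_row_mx df dg.
apply/rowP => j; rewrite diff_rV//; case: (split_ordP j) => i ->.
  rewrite row_mxEl diff_rV//; congr ('d _ x v); by apply/funext => y; rewrite row_mxEl.
rewrite row_mxEr diff_rV//; congr ('d _ x v); by apply/funext => y; rewrite row_mxEr.
Qed.

(* With k the increment of y over h, B a left inverse of the differential of F and
   L h = 'd c t h *m B, the estimate |k - L h| <= b d (|k| + |h|), b d <= 1/2, first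
   bounds |k| by a multiple of |h|, hence |k - L h| by a small multiple of |h|. *)
Lemma differentiable_lift p q (F : 'rV[R]_p -> 'rV[R]_q) (y : V -> 'rV[R]_p) (c : V ->
  'rV[R]_q) t :
  differentiable F (y t) -> injective ('d F (y t)) -> {for t, continuous y} ->
  {near t, F \o y =1 c} -> differentiable c t -> differentiable y t.
Proof.
move=> dF iF cy Fy dc.
have [B AB] : exists B, lin1_mx ('d F (y t)) *m B = 1%:M.
  apply/row_freeP; rewrite -kermx_eq0; apply/eqP/row_matrixP => i; rewrite row0.
  apply: iF; rewrite linear0 -(mul_rV_lin1 ('d F (y t))).
  by apply/sub_kermxP; exact: row_sub.
pose L : {linear V -> 'rV[R]_p} := mulmxr B \o 'd c t.
have cL : continuous L.
  by move=> h; apply: continuous_comp;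
    [exact: diff_continuous|exact: linear_rV_continuous].
have [b b0 hb] := linear_lipschitz
  (@linear_rV_continuous _ _ _ (mulmxr B : {linear 'rV[R]_q -> 'rV[R]_p})).
have [l l0 hl] := linear_lipschitz cL.
suff : is_diff t y L by move=> ?; exact: ex_diff.
apply/diff_estimateP => // e e0.
(* The first bound yields [|k| <= (1 + 2 l) |h|], hence [|k| + |h| <= (2 + 2 l) |h|]; the second
   then makes the error at most [e |h|]. *)
pose d := Num.min ((2 * b)^-1) (e / (b * (2 + 2 * l))).
have bl0 : 0 < b * (2 + 2 * l) by rewrite mulr_gt0// addr_gt0// mulr_gt0.
have d0 : 0 < d by rewrite lt_min invr_gt0 mulr_gt0//= divr_gt0.
have HF : \forall h \near (0 : V),
  `|F (y (h + t) - y t + y t) - F (y t) - 'd F (y t) (y (h + t) - y t)| <=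
    d * `|y (h + t) - y t|.
  have := diff_estimate dF d0.
  suff : (y (h + t) - y t) @[h --> (0 : V)] --> (0 : 'rV[R]_p) by move=> H /H.
  rewrite -[X in _ --> X](subrr (y t)); apply: cvgB; last exact: cvg_cst.
  by move: cy; rewrite continuous_shift; rewrite /prop_for /continuous_at /= add0r.
have Hc := diff_estimate dc d0.
have Hn : \forall h \near (0 : V), F (y (h + t)) = c (h + t).
  have : \forall s \near t, F (y s) = c s by [].
  by rewrite (near_shift 0 t) subr0.
near=> h.
have E1 : F (y (h + t)) = c (h + t) by near: h.
have E0 : F (y t) = c t by exact: (nbhs_singleton Fy).
set k := y (h + t) - y t.
have H1 : `|c (h + t) - c t - 'd F (y t) k| <= d * `|k|.
  have : `|F (y (h + t) - y t + y t) - F (y t) -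
      'd F (y t) (y (h + t) - y t)| <= d * `|y (h + t) - y t| by near: h.
  by rewrite subrK E1 E0.
have H2 : `|c (h + t) - c t - 'd c t h| <= d * `|h| by near: h.
have kE : k = 'd F (y t) k *m B
  by rewrite -(mul_rV_lin1 ('d F (y t))) -mulmxA AB mulmx1.
have H3 : `|k - L h| <= b * (d * `|k| + d * `|h|).
  rewrite {1}kE /L /= -mulmxBl; apply: le_trans (hb _) _; rewrite ler_pM2l//.
  have -> : 'd F (y t) k - 'd c t h =
      (c (h + t) - c t - 'd c t h) - (c (h + t) - c t - 'd F (y t) k).
    have aux (u v w : 'rV[R]_q) : u - v = w - v - (w - u)
      by rewrite opprB [RHS]addrC subrKA.
    exact: aux.
  by rewrite (le_trans (ler_normB _ _))// addrC lerD.
have H4 : `|k| <= `|k - L h| + l * `|h|.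
  rewrite -{1}(subrK (L h) k); apply: le_trans (ler_normD _ _) _.
  by rewrite lerD2l.
have bd1 : b * d * 2 <= 1.
  by rewrite mulrAC mulrC -ler_pdivlMr ?mulr_gt0// mul1r [b * 2]mulrC ge_min lexx.
have bd2 : b * d * (2 + 2 * l) <= e.
  by rewrite mulrAC mulrC -ler_pdivlMr// ge_min lexx orbT.
have := normr_ge0 k; have := normr_ge0 h; move: H3 H4 bd1 bd2.
have : 0 <= b * d by rewrite mulr_ge0// ltW.
rewrite -mulrDr mulrA; move: (b * d) `|k| `|h| `|k - L h| =>
  w K h' X w0 HX HK w1 w2 h0 K0.
have K1 : K <= (1 + 2 * l) * h' by nra.
apply: (le_trans HX); apply: (@le_trans _ _ (w * ((2 + 2 * l) * h')));
  last by rewrite mulrA ler_wpM2r.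
by apply: ler_wpM2l => //; lra.
Unshelve. all: by end_near. Qed.

End Products.

(** * Charts and tangent maps *)

Section LinearInstances.
Variable R : realType.

Lemma dchart_is_linear n (A : atlas R n) (x y : A) : linear (dchart x y).
Proof. by move=> c u v; rewrite /dchart linearP. Qed.
HB.instance Definition _ n (A : atlas R n) (x y : A) :=
  GRing.isLinear.Build R 'rV[R]_n 'rV[R]_n _ (dchart x y) (dchart_is_linear x y).

Lemma dchart_inv_is_linear n (A : atlas R n) (x y : A) : linear (dchart_inv x y).
Proof. by move=> c u v; rewrite /dchart_inv linearP. Qed.
HB.instance Definition _ n (A : atlas R n) (x y : A) :=
  GRing.isLinear.Build R 'rV[R]_n 'rV[R]_n _ (dchart_inv x y)
    (dchart_inv_is_linear x y).

Lemma tmap_is_linear m n (A : atlas R m) (B : atlas R n) (f : A -> B) x :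
  linear (tmap f x).
Proof. by move=> c u v; rewrite /tmap linearP. Qed.
HB.instance Definition _ m n (A : atlas R m) (B : atlas R n) (f : A -> B) x :=
  GRing.isLinear.Build R 'rV[R]_m 'rV[R]_n _ (tmap f x) (tmap_is_linear f x).

Lemma dfun_is_linear n (A : atlas R n) (f : A -> R) x : linear (dfun f x).
Proof. by move=> c u v; rewrite /dfun linearP. Qed.
HB.instance Definition _ n (A : atlas R n) (f : A -> R) x :=
  GRing.isLinear.Build R 'rV[R]_n R _ (dfun f x) (dfun_is_linear f x).

Lemma covector_pairK m n (p : 'rV[R]_m) (L : {linear 'rV[R]_n -> 'rV[R]_m}) u :
  pair (covector (fun v => pair p (L v))) u = pair p (L u).
Proof. exact: (covectorK (pair p \o L)). Qed.

End LinearInstances.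

Lemma openE_atlas (R : realType) n (A : atlas R n) (U : set A) : open U = atlas_open U.
Proof. by []. Qed.

Section Charts.
Variables (R : realType) (n : nat) (A : manifold R n).
Implicit Types x y z w : A.

Lemma chart_dom_refl x : chart_dom x x.
Proof. by case: (manifoldP A) => -[H _ _ _] _ _; exact: H. Qed.

Lemma chartK x y : chart_dom x y -> chart_inv x (chart x y) = y.
Proof. by case: (manifoldP A) => -[_ H _ _] _ _; exact: H. Qed.

Lemma chart_inv_refl x : chart_inv x (chart x x) = x.
Proof. exact/chartK/chart_dom_refl. Qed.

Lemma chart_invK x u : chart_ran x u -> chart x (chart_inv x u) = u.
Proof. by move=> [y xy <-]; rewrite chartK. Qed.

Lemma chart_inv_dom x u : chart_ran x u -> chart_dom x (chart_inv x u).
Proof. by move=> [y xy <-]; rewrite chartK. Qed.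

Definition overlap x y := chart x @` (chart_dom x `&` chart_dom y).

Lemma overlapP x y u : overlap x y u <-> chart_ran x u /\ chart_dom y (chart_inv x u).
Proof.
split=> [[z [xz yz] <-]|[xu yu]]; first by rewrite chartK//; split=> //; exists z.
by exists (chart_inv x u); [split=> //; exact: chart_inv_dom|exact: chart_invK].
Qed.

Lemma open_overlap x y : open (overlap x y).
Proof. by case: (manifoldP A) => -[_ _ H _] _ _; exact: H. Qed.

Lemma overlap_refl x : overlap x x = chart_ran x.
Proof. by rewrite /overlap setIid. Qed.

Lemma open_chart_ran x : open (chart_ran x).
Proof. by rewrite -overlap_refl; exact: open_overlap. Qed.

Lemma chart_ran_refl x : chart_ran x (chart x x).
Proof. by exists x => //; exact: chart_dom_refl. Qed.

Lemma overlap_chart x y z : chart_dom x z -> chart_dom y z -> overlap x y (chart x z).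
Proof. by exists z. Qed.

Lemma smooth_transition x y : smooth_on (overlap x y) (chart y \o chart_inv x).
Proof. by case: (manifoldP A) => -[_ _ _ H] _ _; exact: H. Qed.

Lemma near_overlap x y z : chart_dom x z -> chart_dom y z ->
  \forall u \near chart x z, overlap x y u.
Proof. by move=> xz yz; apply: open_nbhs_nbhs; split;
  [exact: open_overlap|exists z]. Qed.

Lemma differentiable_transition x y z : chart_dom x z -> chart_dom y z ->
  differentiable (chart y \o chart_inv x) (chart x z).
Proof. by move=> xz yz; apply: smooth_on_open (@smooth_transition x y) _; exists z. Qed.

(** The two chart expressions of [h] near [z] differ by the transition map, so this is the chain
    rule. It transports statements made in the chart of one point to the chart of another. *)
Lemma is_diff_transition_comp (W : normedModType R) (h : A -> W) x y z
    (dh : {linear 'rV[R]_n -> W}) :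
  chart_dom x z -> chart_dom y z -> is_diff (chart y z) (h \o chart_inv y) dh ->
  is_diff (chart x z) (h \o chart_inv x)
    (dh \o 'd (chart y \o chart_inv x) (chart x z)).
Proof.
move=> xz yz dhP.
have E : {near chart x z,
  (h \o chart_inv y) \o (chart y \o chart_inv x) =1 h \o chart_inv x}.
  by apply: filterS (near_overlap xz yz) => u /overlapP[xu yu] /=; rewrite chartK.
apply: near_is_diff E _; apply: is_diff_comp.
  exact/differentiableP/differentiable_transition.
by rewrite /= chartK.
Qed.

Lemma diff_transition_comp (W : normedModType R) (h : A -> W) x y z v :
  chart_dom x z -> chart_dom y z -> differentiable (h \o chart_inv y) (chart y z) ->
  'd (h \o chart_inv x) (chart x z) v =
  'd (h \o chart_inv y) (chart y z) ('d (chart y \o chart_inv x) (chart x z) v).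
Proof.
move=> xz yz /differentiableP dh.
exact: diff_apply (is_diff_transition_comp xz yz dh).
Qed.

Lemma diff_transition_id x z v : chart_dom x z ->
  'd (chart x \o chart_inv x) (chart x z) v = v.
Proof.
move=> xz; have E : {near chart x z, idfun =1 chart x \o chart_inv x}.
  by apply: filterS (near_overlap xz xz) => u /overlapP[xu _] /=; rewrite chart_invK.
have H := near_is_diff E (is_diff_linear idfun (chart x z)).
exact: diff_apply H.
Qed.

(** Cocycle rule: passing from the chart at [y] to the preferred chart at [z] and on to the chart at
    [x] is the direct transition. *)
Lemma dchart_dchart_inv x y z u : chart_dom x z -> chart_dom y z ->
  dchart x z (dchart_inv y z u) = 'd (chart x \o chart_inv y) (chart y z) u.
Proof.
move=> xz yz; have zz := chart_dom_refl z.
exact: esym (diff_transition_comp u yz zz (differentiable_transition zz xz)).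
Qed.

Lemma dchartK x z u : chart_dom x z -> dchart x z (dchart_inv x z u) = u.
Proof. by move=> xz; rewrite (dchart_dchart_inv u xz xz);
  exact: diff_transition_id. Qed.

Lemma dchart_invK x z u : chart_dom x z -> dchart_inv x z (dchart x z u) = u.
Proof.
move=> xz; have zz := chart_dom_refl z.
apply: etrans (diff_transition_id u zz).
exact: esym (diff_transition_comp u zz xz (differentiable_transition xz zz)).
Qed.

Lemma dchart_refl x u : dchart x x u = u.
Proof. exact/diff_transition_id/chart_dom_refl. Qed.

Lemma dchart_inv_refl x u : dchart_inv x x u = u.
Proof. exact/diff_transition_id/chart_dom_refl. Qed.

(** Openness is tested at each [z] in its own chart; there the set contains the points near [z] that
    the transition to the chart at [x], a continuous map, sends into [O]. *)
Lemma open_chart_preimage x (O : set 'rV[R]_n) : open O ->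
  open [set z : A | chart_dom x z /\ O (chart x z)].
Proof.
rewrite openE_atlas => oO z [xz Oz]; have zz := chart_dom_refl z.
have := differentiable_continuous (differentiable_transition zz xz).
have ov := near_overlap zz xz.
have nO : nbhs ((chart x \o chart_inv z) (chart z z)) O.
  by rewrite /= chart_inv_refl; exact: open_nbhs_nbhs.
move=> /(_ _ nO) HO; near=> u; split.
  by have /overlapP[] : overlap z x u by near: u.
by near: u.
Unshelve. all: by end_near. Qed.

End Charts.

(** * Differentiable maps and the chain rule *)

Section DifferentiableMaps.
Variables (R : realType) (m n : nat) (A : atlas R m) (B : atlas R n).

(** Charts are total functions, so differentiability of the chart expression does not keep the
    values of [f] where the chart at [f x] is invertible. The second clause adds this, and the chain
    rule relies on it. *)
Definition differentiable_map (f : A -> B) (x : A) :=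
  differentiable (chart (f x) \o f \o chart_inv x) (chart x x) /\
  \forall u \near chart x x,
    chart_inv (f x) (chart (f x) (f (chart_inv x u))) = f (chart_inv x u).

Lemma is_diff_map_comp (W : normedModType R) (f : A -> B) (h : B -> W) x :
  chart_inv x (chart x x) = x -> differentiable_map f x ->
  differentiable (h \o chart_inv (f x)) (chart (f x) (f x)) ->
  is_diff (chart x x) (h \o f \o chart_inv x)
    ('d (h \o chart_inv (f x)) (chart (f x) (f x)) \o tmap f x).
Proof.
move=> xK [df fE] dh.
have E : {near chart x x, (h \o chart_inv (f x)) \o (chart (f x) \o f \o chart_inv x) =1
    h \o f \o chart_inv x}.
  by apply: filterS fE => u /= ->.
apply: near_is_diff E _; apply: is_diff_comp; first exact: differentiableP.
by rewrite /= xK; exact: differentiableP.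
Qed.

Lemma diff_map_comp (W : normedModType R) (f : A -> B) (h : B -> W) x v :
  chart_inv x (chart x x) = x -> differentiable_map f x ->
  differentiable (h \o chart_inv (f x)) (chart (f x) (f x)) ->
  'd (h \o f \o chart_inv x) (chart x x) v =
    'd (h \o chart_inv (f x)) (chart (f x) (f x)) (tmap f x v).
Proof. by move=> xK df dh; exact: diff_apply (is_diff_map_comp xK df dh). Qed.

Lemma smooth_map_differentiable (f : A -> B) x :
  (forall y z : B, chart_dom y z -> chart_inv y (chart y z) = z) ->
  smooth_map f -> differentiable_map f x.
Proof.
move=> BK /(_ x)[U [[oU Ux] _ Ud sU]]; split; first exact: smooth_on_open sU Ux.
by apply: (open_near oU) => // u Uu; apply: BK; exact: Ud.
Qed.

End DifferentiableMaps.

(** * The cotangent bundle *)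

Section CotangentCharts.
Variables (R : realType) (n : nat) (Q : manifold R n).
Implicit Types a b : cotangent Q.

Lemma is_diff_lsubmx m p (y : 'rV[R]_(m + p)) :
  is_diff y (lsubmx : 'rV[R]_(m + p) -> 'rV[R]_m) lsubmx.
Proof. exact: (is_diff_linear lsubmx). Qed.

Lemma is_diff_rsubmx m p (y : 'rV[R]_(m + p)) :
  is_diff y (rsubmx : 'rV[R]_(m + p) -> 'rV[R]_p) rsubmx.
Proof. exact: (is_diff_linear rsubmx). Qed.

Lemma near_lsubmx m p (O : set 'rV[R]_m) (y : 'rV[R]_(m + p)) :
  open O -> O (lsubmx y) -> \forall z \near y, O (lsubmx z).
Proof.
move=> oO Oy; have := @linear_rV_continuous _ _ _ (lsubmx :
  {linear 'rV[R]_(m + p) -> 'rV[R]_m}) y.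
by apply; exact: open_nbhs_nbhs.
Qed.

Lemma cot_chartE a b : chart a b = row_mx (chart a.1 b.1)
  (covector (fun u => pair b.2 (dchart_inv a.1 b.1 u))).
Proof. by []. Qed.

Lemma cot_chart_invE a y : chart_inv a y =
  (chart_inv a.1 (lsubmx y),
   covector (fun u => pair (rsubmx y)
     (dchart a.1 (chart_inv a.1 (lsubmx y)) u))) :> cotangent Q.
Proof. by []. Qed.

Lemma pair_covector_dchart p (x y : Q) v :
  pair (covector (fun u => pair p (dchart x y u))) v = pair p (dchart x y v).
Proof. exact: (covector_pairK p (dchart x y)). Qed.

Lemma pair_covector_dchart_inv p (x y : Q) v :
  pair (covector (fun u => pair p (dchart_inv x y u))) v = pair p (dchart_inv x y v).
Proof. exact: (covector_pairK p (dchart_inv x y)). Qed.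

Lemma cot_chartK a b : chart_dom a b -> chart_inv a (chart a b) = b.
Proof.
case: a b => [q p] [q' p'] /= qq'; rewrite row_mxKl row_mxKr chartK//.
congr (_, _); apply: pair_ext => v.
by rewrite pair_covector_dchart pair_covector_dchart_inv dchart_invK.
Qed.

Lemma cot_chart_refl a : chart a a = row_mx (chart a.1 a.1) a.2.
Proof.
rewrite cot_chartE; congr row_mx; apply: pair_ext => v.
by rewrite pair_covector_dchart_inv dchart_inv_refl.
Qed.

(** Covectors change chart by the transpose of the differential of the inverse transition, taken at
    the new base coordinates. *)
Lemma cot_transitionE a b (y : 'rV[R]_(n + n)) : overlap a.1 b.1 (lsubmx y) ->
  chart b (chart_inv a y) = row_mx ((chart b.1 \o chart_inv a.1) (lsubmx y))
    (covector (fun u => pair (rsubmx y)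
       ('d (chart a.1 \o chart_inv b.1) ((chart b.1 \o chart_inv a.1) (lsubmx y)) u))).
Proof.
move=> /overlapP[ya yb]; rewrite cot_chartE cot_chart_invE.
apply: (congr2 row_mx (erefl _)); apply/rowP => j; rewrite [LHS]mxE [RHS]mxE.
rewrite pair_covector_dchart; apply: (congr1 (pair _)).
exact: (dchart_dchart_inv _ (chart_inv_dom ya) yb).
Qed.

Lemma near_cot_overlap a b : chart_dom a b ->
  \forall y \near chart a b, overlap a.1 b.1 (lsubmx y).
Proof.
move=> ab; apply: near_lsubmx; first exact: open_overlap.
by rewrite row_mxKl; exists b.1 => //; split=> //; exact: chart_dom_refl.
Qed.

Lemma differentiable_cot_transition a b : chart_dom a b ->
  differentiable (chart b \o chart_inv a) (chart a b).
Proof.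
move=> ab; have bb := chart_dom_refl b.1.
pose F y := row_mx ((chart b.1 \o chart_inv a.1) (lsubmx y))
    (covector (fun u => pair (rsubmx y)
       ('d (chart a.1 \o chart_inv b.1) ((chart b.1 \o chart_inv a.1) (lsubmx y)) u))).
apply: (@near_differentiable _ _ _ F).
  by apply: filterS (near_cot_overlap ab) => y yo; exact: esym (cot_transitionE yo).
have dT : differentiable ((chart b.1 \o chart_inv a.1) \o (lsubmx : 'rV[R]_(n + n) ->
  _)) (chart a b).
  apply: differentiable_comp; first by case: (is_diff_lsubmx (chart a b)).
  by rewrite row_mxKl; exact: differentiable_transition.
apply: differentiable_row_mx => //; apply: differentiable_rV => j.
have -> : (fun y : 'rV[R]_(n + n) => covector (fun u : 'rV[R]_n => pair (rsubmx y)
    ('d (chart a.1 \o chart_inv b.1) ((chart b.1 \o chart_inv a.1) (lsubmx y)) u)) 0 j :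
      R) =
  fun y => pair (rsubmx y) (((fun z =>
    'd (chart a.1 \o chart_inv b.1) z (delta_mx 0 j)) \o
    ((chart b.1 \o chart_inv a.1) \o (lsubmx : 'rV[R]_(n + n) -> _))) y).
  by apply/funext => y; rewrite mxE.
apply: differentiable_pair; first by case: (is_diff_rsubmx (chart a b)).
apply: differentiable_comp => //=.
rewrite row_mxKl chartK//.
(* The fibre part contains the differential of a base transition, so its differentiability comes
   from the transition being C^2. *)
have [_ H] := @smooth_transition _ _ Q b.1 a.1 2%N.
by have [+ _] := H (delta_mx 0 j); apply; exists b.1.
Qed.

Lemma lsubmx_cot_dchart_inv a b u : chart_dom a b ->
  lsubmx (dchart_inv a b u) = dchart_inv a.1 b.1 (lsubmx u).
Proof.
move=> ab; have bb := chart_dom_refl b.1.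
have dF := differentiable_cot_transition ab.
have E1 := diff_linear_comp (lsubmx : {linear 'rV[R]_(n + n) -> 'rV[R]_n}) u dF.
have H : is_diff (chart a b) (lsubmx \o (chart b \o chart_inv a))
   ('d (chart b.1 \o chart_inv a.1) (chart a.1 b.1) \o (lsubmx : 'rV[R]_(n + n) -> _)).
  have E : {near chart a b, (chart b.1 \o chart_inv a.1) \o (lsubmx : 'rV[R]_(n + n) ->
    _) =1
     lsubmx \o (chart b \o chart_inv a)}.
    by apply: filterS (near_cot_overlap ab) => y _ /=; rewrite row_mxKl.
  apply: near_is_diff E _; apply: is_diff_comp; first exact: is_diff_lsubmx.
  by rewrite row_mxKl; exact/differentiableP/differentiable_transition.
exact: etrans (esym E1) (diff_apply u H).
Qed.

Lemma tmap_cot_proj a v : tmap (@cot_proj R n Q) a v = lsubmx v.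
Proof.
have aa := chart_dom_refl a.1.
have E : {near chart a a, lsubmx =1
  chart (cot_proj a) \o @cot_proj R n Q \o chart_inv a}.
  apply: filterS (near_cot_overlap (aa : chart_dom a a)) => y /overlapP[ya _] /=.
  by rewrite chart_invK.
exact: diff_apply (near_is_diff E (is_diff_lsubmx _)).
Qed.

Lemma ThetaE a v : Theta a v = pair a.2 (lsubmx v).
Proof. by rewrite /Theta tmap_cot_proj. Qed.

(** The canonical form is [p_i dq^i] throughout the induced chart: the change of chart in the
    covector cancels the one in the vector. *)
Lemma form_rep_Theta a u y : chart_ran a.1 (lsubmx y) ->
  form_rep (@Theta R n Q) a u y = pair (rsubmx y) (lsubmx u).
Proof.
move=> ya; have yd := chart_inv_dom ya.
rewrite /form_rep ThetaE lsubmx_cot_dchart_inv//=.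
by rewrite pair_covector_dchart dchartK.
Qed.

Lemma diff_form_rep_Theta a u v :
  'd (form_rep (@Theta R n Q) a v) (chart a a) u = pair (rsubmx u) (lsubmx v).
Proof.
have E : {near chart a a, (pair (lsubmx v) \o rsubmx) =1 form_rep (@Theta R n Q) a v}.
  apply: filterS (near_cot_overlap (chart_dom_refl a.1 : chart_dom a a)) =>
    y /overlapP[ya _] /=.
  by rewrite form_rep_Theta// pairC.
have H := near_is_diff E (is_diff_linear _ _).
by rewrite pairC; exact: diff_apply H.
Qed.

(** On constant fields [Theta] is linear in the fibre coordinates, so [Omega] is [dq^i /\ dp_i]. *)
Lemma OmegaE a u v :
  Omega a u v = pair (rsubmx v) (lsubmx u) - pair (rsubmx u) (lsubmx v).
Proof. by rewrite /Omega /ext_deriv !diff_form_rep_Theta opprB. Qed.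

(** The existence half of nondegeneracy, which gives the chosen vector [cot_lift] its defining
    property. *)
Lemma Omega_nondegenerate a (l : {linear 'rV[R]_(n + n) -> R}) :
  exists v, forall w, Omega a v w = l w.
Proof.
(* The base part of the solution is [l] on fibre directions, its fibre part is minus [l] on base
   directions. *)
pose lp (u : 'rV[R]_n) := l (row_mx 0 u); pose lq (u : 'rV[R]_n) := - l (row_mx u 0).
have lpL : linear lp by move=> c u v;
  rewrite /lp -linearP scale_row_mx add_row_mx scaler0 addr0.
have lqL : linear lq.
  by move=> c u v; rewrite /lq scalerN -opprD -linearP scale_row_mx add_row_mx scaler0
    addr0.
pose lpl : {linear 'rV[R]_n -> R} := HB.pack lp (GRing.isLinear.Build _ _ _ _ lp lpL).
pose lql : {linear 'rV[R]_n -> R} := HB.pack lq (GRing.isLinear.Build _ _ _ _ lq lqL).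
exists (row_mx (covector lpl) (covector lql)) => w.
rewrite OmegaE row_mxKl row_mxKr pairC !covectorK /= /lp /lq opprK -linearD.
by rewrite add_row_mx add0r addr0 hsubmxK.
Qed.

End CotangentCharts.

(** * Lifting through embeddings *)

Section Embeddings.
Variables (R : realType) (m n : nat) (A : manifold R m) (B : atlas R n).
Variable iota : A -> B.
Hypothesis BK : forall y z : B, chart_dom y z -> chart_inv y (chart y z) = z.
Hypothesis emb : embedding iota.

Lemma embedding_differentiable x : differentiable_map iota x.
Proof. by case: emb => smi _ _ _; exact: smooth_map_differentiable. Qed.

(** By the last clause of [embedding], chart neighbourhoods of [gam t] are preimages of open sets of
    [B], so [gam] is continuous at [t] and [differentiable_lift] applies. The arbitrary source [V]
    covers curves, local sections and orbit maps alike. *)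
Lemma differentiable_embedding_lift (V : normedModType R) (gam : V -> A) (c : V ->
  'rV[R]_n) t :
  (\forall s \near t, iota (gam s) = chart_inv (iota (gam t)) (c s) /\
     chart (iota (gam t)) (iota (gam s)) = c s) ->
  differentiable c t ->
  [/\ \forall s \near t, chart_dom (gam t) (gam s),
      differentiable (chart (gam t) \o gam) t &
      forall v, 'd c t v = tmap iota (gam t) ('d (chart (gam t) \o gam) t v)].
Proof.
move=> Hc dc; set x := gam t; set a := iota x.
have [dF FE] := embedding_differentiable x; case: emb => _ _ iF opi.
have ct : c t = chart a a by case: (nbhs_singleton Hc).
have gam_near (O : set 'rV[R]_m) : open O -> O (chart x x) ->
    \forall s \near t, chart_dom x (gam s) /\ O (chart x (gam s)).
  move=> oO Ox; have [W oW WE] := opi _ (open_chart_preimage (x := x) oO).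
  have Wa : (iota @^-1` W) x by rewrite -WE; split=> //; exact: chart_dom_refl.
  move: oW; rewrite openE_atlas => /(_ _ Wa) Wn.
  have := differentiable_continuous dc;
    rewrite /prop_for /continuous_at ct => /(_ _ Wn) Wc.
  near=> s; have [E _] : iota (gam s) = chart_inv a (c s) /\ chart a (iota (gam s)) =
    c s by near: s.
  have : (iota @^-1` W) (gam s) by rewrite /preimage/= E; near: s.
  by rewrite -WE.
have dom : \forall s \near t, chart_dom x (gam s).
  by have := gam_near _ openT I; apply: filterS => s [].
have cg : {for t, continuous (chart x \o gam)}.
  move=> O /=; rewrite nbhsE => -[P [oP Px] PO].
  by have := gam_near _ oP Px; apply: filterS => s [_ /PO].
have Fg : {near t, (chart a \o iota \o chart_inv x) \o (chart x \o gam) =1 c}.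
  near=> s; have [_ E] : iota (gam s) = chart_inv a (c s) /\ chart a (iota (gam s)) =
    c s by near: s.
  by rewrite /= chartK//; near: s.
have dg : differentiable (chart x \o gam) t
  by apply: differentiable_lift dF (iF x) cg Fg dc.
split=> // v; have H := near_is_diff Fg
  (is_diff_comp (differentiableP dg) (differentiableP dF)).
exact: diff_apply H.
Unshelve. all: by end_near. Qed.

(** The lift is chosen pointwise; injectivity of [iota] forces it through [x] at [t], and its
    derivative there is the required tangent vector. *)
Lemma tangent_range (V : normedModType R) x (c : V -> 'rV[R]_n) t v :
  c t = chart (iota x) (iota x) ->
  (\forall s \near t, range iota (chart_inv (iota x) (c s)) /\
     chart (iota x) (chart_inv (iota x) (c s)) = c s) ->
  chart_dom (iota x) (iota x) ->
  differentiable c t -> exists u, 'd c t v = tmap iota x u.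
Proof.
move=> ct Hc aa dc; set a := iota x.
pose gam s := xget x [set y | iota y = chart_inv a (c s)].
have ii : injective iota by case: emb.
have gamt : gam t = x.
  by rewrite /gam ct BK//; apply: xget_unique => // y /ii.
have Hg : \forall s \near t, iota (gam s) = chart_inv (iota (gam t)) (c s) /\
     chart (iota (gam t)) (iota (gam s)) = c s.
  apply: filterS Hc => s [[y _ yE] cE].
  have E : iota (gam s) = chart_inv a (c s) by rewrite /gam;
    exact: (@xgetPex _ x [set y | iota y = chart_inv a (c s)] (ex_intro _ y yE)).
  by rewrite gamt E.
have [_ _ H] := differentiable_embedding_lift Hg dc.
by rewrite H gamt; eexists.
Qed.

End Embeddings.

Lemma mem_span_codomP (R : realType) n r (f : 'I_r -> 'rV[R]_n) v :
  v \in <<codom f>>%VS <-> exists c : 'I_r -> R, v = \sum_i c i *: f i.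
Proof.
split=> [|[c ->]]; last first.
  by apply: rpred_sum => i _; apply: rpredZ; apply: memv_span; exact: codom_f.
rewrite span_def big_image /= => /memv_sumP[g gE ->].
have /choice[c cE] : forall i, exists k, g i = k *: f i by move=> i; exact/vlineP/gE.
by exists c; apply: eq_bigr => i _; rewrite cE.
Qed.

(** * Representing covectors on a subspace *)

Section Riesz.
Variables (R : realType) (n : nat) (K : 'M[R]_n).
Hypothesis Kpos : forall v : 'rV[R]_n, v != 0 -> 0 < (v *m K *m v^T) 0 0.

(** A linear system for the coefficients of [d] in a basis of [D], whose matrix is the Gram matrix
    [B K B^T]. *)
Lemma riesz_subspace (D : {vspace 'rV[R]_n}) (l : 'rV[R]_n) :
  exists2 d, d \in D & forall b, b \in D -> pair (d *m K) b = pair l b.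
Proof.
pose B := \matrix_(i < \dim D) (vbasis D)`_i.
have DB b : b \in D -> exists x : 'rV_(\dim D), b = x *m B.
  move=> bD; exists (\row_i coord (vbasis D) i b); rewrite mulmx_sum_row.
  rewrite {1}(coord_vbasis bD); apply: eq_bigr => i _.
  by rewrite mxE rowK.
have BD (x : 'rV_(\dim D)) : x *m B \in D.
  rewrite mulmx_sum_row; apply: rpred_sum => i _; apply: rpredZ; rewrite rowK.
  by apply: vbasis_mem; apply: mem_nth; rewrite size_tuple.
(* With [Z] the cokernel of the Gram matrix and [W = B^T Z], one has [W^T K W = 0]. The diagonal
   entries are the form [K] on the columns of [W], so positivity gives [W = 0] and the system is
   solvable. *)
have /submxP[c cE] : (l *m B^T <= B *m K *m B^T)%MS.
  rewrite submxE; set Z := cokermx _.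
  have ZE : B *m K *m B^T *m Z = 0 by exact: mulmx_coker.
  rewrite -mulmxA; set W := B^T *m Z.
  have WE : W^T *m K *m W = 0.
    by rewrite /W trmx_mul trmxK -!mulmxA [B *m _]mulmxA (mulmxA (B *m K)) ZE mulmx0.
  suff -> : W = 0 by rewrite mulmx0.
  apply: trmx_inj; apply/row_matrixP => i; rewrite trmx0 row0.
  apply/eqP/negP => /negP /Kpos; suff -> :
    (row i W^T *m K *m (row i W^T)^T) 0 0 = (W^T *m K *m W) i i.
    by rewrite WE mxE ltxx.
  rewrite -row_mul -tr_col trmxK !mxE; apply: eq_bigr => j _; by rewrite !mxE.
exists (c *m B); first exact: BD.
move=> b /DB[x ->]; rewrite /pair trmx_mul !mulmxA; congr (fun_of_matrix (_ *m _) _ _).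
by rewrite cE !mulmxA.
Qed.
End Riesz.

(** * The constraint submanifold *)

Section ConstraintSubmanifold.
Variables (R : realType) (n r : nat) (Q : manifold R n).
Variables (N : nonholonomic_system r Q) (M : manifold R (n + r)).
Variable iota : M -> cotangent Q.
Hypothesis hM : is_constraint_submanifold N iota.
Local Notation K := (metric N).
Local Notation D := (constr N).

Lemma metric_pos q (v : 'rV[R]_n) : v != 0 -> 0 < (v *m K q *m v^T) 0 0.
Proof. by case: (metricP N) => _ + _; apply. Qed.

Lemma metric_formE q v w : metric_form K q v w = pair (flat N q v) w.
Proof. by []. Qed.

Lemma metric_formC q v w : metric_form K q v w = metric_form K q w v.
Proof.
case: (metricP N) => sK _ _; rewrite /metric_form -[in LHS](trmxK (_ *m _)) mxE.
by rewrite !trmx_mul trmxK sK mulmxA.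
Qed.

Lemma flat_is_linear q : linear (flat N q).
Proof. by move=> c u v; rewrite /flat mulmxDl scalemxAl. Qed.
HB.instance Definition _ q :=
  GRing.isLinear.Build R 'rV[R]_n 'rV[R]_n _ (flat N q) (flat_is_linear q).

Lemma flat_definite q v : pair (flat N q v) v = 0 -> v = 0.
Proof. by move=> H; apply/eqP/negP => /negP /(metric_pos q); rewrite -metric_formE in H;
  rewrite -/(metric_form K q v v) H ltxx. Qed.

Lemma iota_emb : embedding iota.
Proof. by case: hM. Qed.

Lemma iota_differentiable m : differentiable_map iota m.
Proof. by apply: embedding_differentiable; [exact: cot_chartK|exact: iota_emb]. Qed.

Lemma range_iotaP a : range iota a <-> exists2 v, v \in D a.1 & a.2 = flat N a.1 v.
Proof. by case: hM => _ ->. Qed.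

Lemma iota_flat m : exists2 v, v \in D (iota m).1 & (iota m).2 = flat N (iota m).1 v.
Proof. by apply/range_iotaP; exists m. Qed.

(** Fibres of [kappa^flat(D)] are linear, so the line [p + t kappa^flat(d)] over a fixed base point
    stays in the image of [iota]; it is affine in the chart at [iota m]. *)
Lemma tangent_vertical m d : d \in D (iota m).1 ->
  exists u, tmap iota m u = row_mx 0 (flat N (iota m).1 d).
Proof.
move=> dD; set a := iota m; have [v vD pE] := iota_flat m.
pose e : 'rV[R]_(n + n) := row_mx 0 (flat N a.1 d).
pose c (t : R) := row_mx (chart a.1 a.1) a.2 + t *: e.
have aa : chart_dom a a := chart_dom_refl a.1.
have dc : is_diff (0 : R) c (fun t => t *: e).
  have := is_diffD (is_diff_cst (row_mx (chart a.1 a.1) a.2) 0) (is_diff_scalel 0 e).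
  by congr is_diff_def; apply/funext => t; rewrite fctE add0r.
have cE t : c t = row_mx (chart a.1 a.1) (a.2 + t *: flat N a.1 d).
  by rewrite /c /e scale_row_mx add_row_mx scaler0 addr0.
have ciE t : chart_inv a (c t) = (a.1, a.2 + t *: flat N a.1 d) :> cotangent Q.
  rewrite cE cot_chart_invE row_mxKl row_mxKr chart_inv_refl.
  congr (_, _); apply: pair_ext => w.
  by rewrite pair_covector_dchart dchart_refl.
have c0 : c 0 = chart a a by rewrite cE scale0r addr0 cot_chart_refl.
have Hc : \forall t \near (0 : R),
  range iota (chart_inv a (c t)) /\ chart a (chart_inv a (c t)) = c t.
  near=> t; rewrite ciE; split.
    apply/range_iotaP; exists (v + t *: d); first by rewrite rpredD ?rpredZ.
    by rewrite linearD linearZ /= pE.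
  rewrite cot_chartE cE; congr row_mx; apply: pair_ext => w.
  by rewrite pair_covector_dchart_inv dchart_inv_refl.
have [u uE] := tangent_range (@cot_chartK _ _ Q) iota_emb (1 :
  R) c0 Hc aa (ex_diff (is_diff_def := dc)).
exists u; by rewrite -uE (diff_apply (1 : R) dc) scale1r.
Unshelve. all: by end_near. Qed.

(** The vector [v] at [m] is extended with constant coefficients [k] in a local frame of [D], then
    lowered by the metric. The base component of this section is the identity, so its derivatives
    reach every direction of [Q]. *)
Lemma local_constraint_section m : let a := iota m in
  exists (U : set 'rV[R]_n) (H : 'rV[R]_n -> 'rV[R]_(n + n)),
  [/\ nbhs (chart a.1 a.1) U, H (chart a.1 a.1) = chart a a,
    forall y, U y -> [/\ lsubmx (H y) = y, range iota (chart_inv a (H y)) &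
      chart a (chart_inv a (H y)) = H y] & differentiable H (chart a.1 a.1)].
Proof.
set a := iota m; have [v vD pE] := iota_flat m.
have [U [F [[oU Ua] Uran sF DE]]] := (constrP N).2 a.1.
have nU : nbhs (chart a.1 a.1) U := open_nbhs_nbhs (conj oU Ua).
have := vD; rewrite -{1}(chart_inv_refl a.1) (DE _ Ua) chart_inv_refl =>
  /mem_span_codomP[k vE].
have {}vE : v = \sum_i k i *: F i (chart a.1 a.1).
  by rewrite vE; apply: eq_bigr => i _; rewrite dchart_inv_refl.
pose z y := chart_inv a.1 y.
pose X y := \sum_i k i *: dchart_inv a.1 (z y) (F i y).
pose b y : cotangent Q := (z y, flat N (z y) (X y)).
pose H y := chart a (b y).
have aa : chart_dom a a := chart_dom_refl a.1.
have Hl y : U y -> lsubmx (H y) = y.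
  by move=> /Uran yr; rewrite /H /b cot_chartE row_mxKl /= chart_invK.
have Hi y : U y -> chart_inv a (H y) = b y.
  by move=> /Uran /chart_inv_dom zd; exact: cot_chartK.
have H0 : H (chart a.1 a.1) = chart a a.
  apply: (congr1 (chart a)); rewrite /b /X /z chart_inv_refl [RHS]surjective_pairing pE
    vE.
  by congr (_, flat N _ _); apply: eq_bigr => i _; rewrite dchart_inv_refl.
exists U, H; split; [exact: nU|exact: H0| |].
  move=> y Uy; split; first exact: Hl.
    apply: (eq_ind_r (fun e => range iota e) _ (Hi y Uy)).
    apply/range_iotaP; exists (X y); last by [].
    by rewrite /= /z (DE y Uy); apply/mem_span_codomP; exists k.
  refine (@eq_ind_r _ (b y) (fun e => chart a e = H y) _ _ (Hi y Uy)); reflexivity.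
  (* [g] is the metric in the coordinates of the chart at [a.1], smooth by [is_riemannian]; [H'] is
     [H] written with it. *)
  pose g l j y := metric_form K (z y) (dchart_inv a.1 (z y) (delta_mx 0 l))
                               (dchart_inv a.1 (z y) (delta_mx 0 j)).
  pose H' y := row_mx y (\row_j \sum_i k i * \sum_l F i y 0 l * g l j y).
  apply: (@near_differentiable _ _ _ H').
      apply: filterS nU => y Uy; rewrite /H /b cot_chartE /H' /= chart_invK;
        last exact: Uran.
    congr row_mx; apply/rowP => j; rewrite !mxE /X !linear_sum pairC linear_sum;
      apply: eq_bigr => i _.
    rewrite !linearZ /=; congr (_ * _).
    rewrite [dchart_inv _ _ (F i y)]linear_rV_sum !linear_sum; apply: eq_bigr => l _.
    by rewrite !linearZ /= pairC.
  apply: differentiable_row_mx; first exact: ex_diff.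
  apply: differentiable_rV => j.
  have -> : (fun y => (\row_j \sum_i k i * \sum_l F i y 0 l * g l j y) 0 j : R) =
      fun y => \sum_i k i * \sum_l F i y 0 l * g l j y by apply/funext => y;
        rewrite mxE.
  apply: differentiable_bigsum => i.
  apply: (@differentiableZ _ _ _ (fun y => \sum_l F i y 0 l * g l j y)).
  apply: differentiable_bigsum => l.
  apply: (@differentiableM _ _ (fun y => F i y 0 l : R) (g l j)).
    by apply: differentiable_rV_coord; exact: smooth_on_open (sF i) Ua.
  case: (metricP N) => _ _ sK; apply: smooth_on_open (sK a.1 _ _) _;
    exact: chart_ran_refl.
Qed.

Lemma tangent_horizontal m w : exists u, lsubmx (tmap iota m u) = w.
Proof.
have [U [H [nU H0 HU dH]]] := local_constraint_section m;
  set a := iota m in nU H0 HU dH *.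
have aa : chart_dom a a := chart_dom_refl a.1.
have HN : \forall y \near chart a.1 a.1, range iota (chart_inv a (H y)) /\
    chart a (chart_inv a (H y)) = H y.
  by apply: filterS nU => y /HU[].
have [u uE] := tangent_range (@cot_chartK _ _ Q) iota_emb w H0 HN aa dH.
exists u; rewrite -uE.
have E1 := diff_linear_comp (lsubmx : {linear 'rV[R]_(n + n) -> 'rV[R]_n}) w dH.
have E2 : {near chart a.1 a.1, idfun =1 (lsubmx : 'rV[R]_(n + n) -> 'rV[R]_n) \o H}.
  by apply: filterS nU => y /HU[/= ->].
exact: etrans (esym E1) (diff_apply w (near_is_diff E2 (is_diff_linear idfun _))).
Qed.

Lemma tmap_tauM m v : tmap (tauM iota) m v = lsubmx (tmap iota m v).
Proof.
have dp : differentiable ((chart (iota m).1 \o @cot_proj R n Q) \o chart_inv (iota m))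
  (chart (iota m) (iota m)).
  have dl : is_diff (chart (iota m) (iota m)) (lsubmx : 'rV[R]_(n + n) ->
    'rV[R]_n) lsubmx.
    exact: is_diff_lsubmx.
  have aa : chart_dom (iota m) (iota m) := chart_dom_refl (iota m).1.
  apply: near_differentiable (ex_diff (is_diff_def := dl)).
  apply: filterS (near_cot_overlap aa) => y /overlapP[ya _] /=.
  by rewrite chart_invK.
apply: etrans (tmap_cot_proj (iota m : cotangent Q) (tmap iota m v)).
exact: (diff_map_comp v (chart_inv_refl m) (iota_differentiable m) dp).
Qed.

Lemma CME m v : CM N iota m v = (lsubmx (tmap iota m v) \in D (iota m).1).
Proof. by rewrite /CM /= tmap_tauM. Qed.

(** Some tangent vector [u0] has the base part of [v]. A vertical correction [u1] makes the
    remaining fibre difference vanish on [D]; being vertical, this difference is then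
    [Omega]-orthogonal to [C]. *)
Lemma projCP m (v : 'rV[R]_(n + n)) : lsubmx v \in D (iota m).1 ->
  CM N iota m (projC N iota m v) /\
  forall w, CM N iota m w ->
    Omega (iota m) (v - tmap iota m (projC N iota m v)) (tmap iota m w) = 0.
Proof.
move=> vD; apply: (@xgetPex _ _ [set u | CM N iota m u /\
  forall w, CM N iota m w -> Omega (iota m) (v - tmap iota m u) (tmap iota m w) = 0]).
have [u0 u0E] := tangent_horizontal m (lsubmx v).
have [d dD dE] := riesz_subspace (@metric_pos (iota m).1) (D (iota m).1)
  (rsubmx v - rsubmx (tmap iota m u0)).
have [u1 u1E] := tangent_vertical dD.
exists (u0 + u1) => /=; have E : lsubmx (tmap iota m (u0 + u1)) = lsubmx v.
  by rewrite !linearD /= u0E u1E row_mxKl addr0.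
split=> [|w]; first by rewrite CME E.
rewrite CME => wD; rewrite OmegaE !linearB /= E subrr sub0r; apply/eqP;
  rewrite oppr_eq0.
by rewrite linearD /= linearD /= u1E row_mxKr opprD addrA pairDl -dE// pairNl subrr.
Qed.

(** [Omega] against [(0, kappa^flat(d))] returns [kappa(d, -)] of the base part. Taking for [d] the
    base difference itself gives [kappa(d, d) = 0]. *)
Lemma lsubmx_projC m (v : 'rV[R]_(n + n)) : lsubmx v \in D (iota m).1 ->
  lsubmx (tmap iota m (projC N iota m v)) = lsubmx v.
Proof.
move=> vD; have [+ H] := projCP vD; set u := projC N iota m v; rewrite CME => uD.
have dD : lsubmx v - lsubmx (tmap iota m u) \in D (iota m).1 by rewrite rpredB.
have [w wE] := tangent_vertical dD.
have wC : CM N iota m w by rewrite CME wE row_mxKl mem0v.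
have := H w wC; rewrite OmegaE wE row_mxKl row_mxKr linear0 subr0 (linearB lsubmx) =>
  H0.
by apply/esym/eqP; rewrite -subr_eq0; apply/eqP; exact: flat_definite H0.
Qed.

End ConstraintSubmanifold.

(** * The Hamiltonian *)

(* Otherwise unification unfolds differentials at distinct points down to their
   neighbourhood filters. *)
Local Opaque dchart dchart_inv.

Section Hamiltonian.
Variables (R : realType) (n r : nat) (Q : manifold R n).
Variables (N : nonholonomic_system r Q).
Local Notation K := (metric N).
Implicit Types (a b : cotangent Q).

Lemma metric_unit q : K q \in unitmx.
Proof.
rewrite -row_free_unit -kermx_eq0; apply/eqP/row_matrixP => i; rewrite row0.
apply: (@flat_definite _ _ _ _ N q); rewrite /flat.
have /sub_kermxP -> : (row i (kermx (K q)) <= kermx (K q))%MS by exact: row_sub.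
exact: pair0l.
Qed.

Lemma flatK q v : flat N q v *m invmx (K q) = v.
Proof. by rewrite /flat mulmxK// metric_unit. Qed.

Lemma invmx_metricK q p : flat N q (p *m invmx (K q)) = p.
Proof. by rewrite /flat mulmxKV// metric_unit. Qed.

Lemma pair_invmx_metricC q p (p' : 'rV[R]_n) :
  pair p (p' *m invmx (K q)) = pair p' (p *m invmx (K q)).
Proof.
rewrite -{1}(invmx_metricK q p) -{2}(invmx_metricK q p').
exact: metric_formC.
Qed.

Lemma hamiltonianE b : hamiltonian N b =
  pair b.2 (b.2 *m invmx (K b.1)) / 2 + potential N b.1.
Proof.
rewrite /hamiltonian /lagrangian metric_formE invmx_metricK.
by rewrite opprB addrCA addrC {1}(splitr (pair _ _)) addrK.
Qed.

(** The coefficients [g_ij] in the one chart at [x]; [metric] is read at each point in that point's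
    own chart and has no evident regularity. *)
Definition local_metric (x : Q) y : 'M[R]_n := \matrix_(i, j)
  metric_form K (chart_inv x y) (dchart_inv x (chart_inv x y) (delta_mx 0 i))
                                (dchart_inv x (chart_inv x y) (delta_mx 0 j)).

(** With [J] the matrix of [dchart] and [J'] its inverse, the local metric is [J' K J'^T], so
    [J^T K^-1 J] inverts it. *)
Lemma local_metric_inv x y : chart_ran x y ->
  local_metric x y *m ((lin1_mx (dchart x (chart_inv x y)))^T *m
    invmx (K (chart_inv x y)) *m lin1_mx (dchart x (chart_inv x y))) = 1%:M.
Proof.
move=> /chart_inv_dom; rewrite /local_metric; set z := chart_inv x y => xz.
have [J JE] : exists J : 'M[R]_n, lin1_mx (dchart x z) = J /\ forall u,
  u *m J = dchart x z u.
  by exists (lin1_mx (dchart x z)); split=> // u; exact: mul_rV_lin1.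
have [J' J'E] : exists J : 'M[R]_n, forall u, u *m J = dchart_inv x z u.
  by exists (lin1_mx (dchart_inv x z)) => u; exact: mul_rV_lin1.
case: JE => -> JE.
have -> : (\matrix_(i, j) metric_form K z (dchart_inv x z (delta_mx 0 i))
  (dchart_inv x z (delta_mx 0 j)))
    = J' *m K z *m J'^T.
  apply/matrixP => i j; rewrite mxE /metric_form -!J'E -!rowE.
  by rewrite -row_mul tr_row !mxE; apply: eq_bigr => k _; rewrite !mxE.
have JJ' : J *m J' = 1%:M.
  by apply/row_matrixP => i; rewrite !rowE mulmxA mulmx1 J'E JE dchart_invK.
by rewrite -!mulmxA (mulmxA J'^T) -trmx_mul JJ' trmx1 mul1mx
  (mulmxA (K z)) mulmxV ?metric_unit// mul1mx; exact: mulmx1C.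
Qed.

Lemma local_metric_unit x y : chart_ran x y -> local_metric x y \in unitmx.
Proof. by move=> /local_metric_inv /mulmx1_unit[]. Qed.

(** The coordinate formula [H = 1/2 g^ij p_i p_j + V], from which differentiability can be read
    off. *)
Lemma hamiltonian_chart a y : chart_ran a.1 (lsubmx y) ->
  hamiltonian N (chart_inv a y) =
    pair (rsubmx y) (rsubmx y *m invmx (local_metric a.1 (lsubmx y))) / 2 +
    potential N (chart_inv a.1 (lsubmx y)).
Proof.
move=> yr; rewrite hamiltonianE /=; congr (_ / 2 + _).
set z := chart_inv a.1 (lsubmx y); have LI := local_metric_inv yr; rewrite -/z in LI.
have [J [EJ JE]] : exists J : 'M[R]_n, lin1_mx (dchart a.1 z) = J /\ forall u,
  u *m J = dchart a.1 z u.
  by exists (lin1_mx (dchart a.1 z)); split=> // u; exact: mul_rV_lin1.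
rewrite EJ in LI.
have -> : covector (fun v => pair (rsubmx y) (dchart a.1 z v)) = rsubmx y *m J^T.
  apply: pair_ext => v; rewrite pair_covector_dchart -JE.
  by rewrite /pair trmx_mul mulmxA.
have -> : invmx (local_metric a.1 (lsubmx y)) = J^T *m invmx (K z) *m J.
  by rewrite -[RHS](mulKmx (local_metric_unit yr)) LI mulmx1.
by rewrite /pair !trmx_mul !trmxK !mulmxA.
Qed.

Lemma differentiable_hamiltonian a :
  differentiable (hamiltonian N \o chart_inv a) (chart a a).
Proof.
have aa : chart_dom a a := chart_dom_refl a.1.
have E := near_cot_overlap aa.
pose f y := 2^-1 * pair (rsubmx y) (rsubmx y *m invmx (local_metric a.1 (lsubmx y))).
pose g := (potential N \o chart_inv a.1) \o (lsubmx : 'rV[R]_(n + n) -> 'rV[R]_n).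
apply: (@near_differentiable _ _ _ (f + g)).
  by apply: filterS E => y /overlapP[yr _] /=; rewrite hamiltonian_chart// [_ / 2]mulrC.
have dl : differentiable (lsubmx : 'rV[R]_(n + n) -> 'rV[R]_n) (chart a a).
  by case: (is_diff_lsubmx (chart a a)).
have dr : differentiable (rsubmx : 'rV[R]_(n + n) -> 'rV[R]_n) (chart a a).
  by case: (is_diff_rsubmx (chart a a)).
have lE : lsubmx (chart a a) = chart a.1 a.1 by rewrite row_mxKl.
apply: differentiableD; last first.
  apply: differentiable_comp; first exact: dl.
  by rewrite lE; apply: smooth_on_open (potentialP N a.1) _; exact: chart_ran_refl.
apply: (@differentiableZ _ _ _ (fun y =>
  pair (rsubmx y) (rsubmx y *m invmx (local_metric a.1 (lsubmx y))))).
apply: differentiable_pair; first exact: dr.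
apply: differentiable_mulmx; first exact: dr.
apply: differentiable_invmx => [|i j].
  by apply: filterS E => y /overlapP[yr _]; exact: local_metric_unit.
pose h y := metric_form K (chart_inv a.1 y)
  (dchart_inv a.1 (chart_inv a.1 y) (delta_mx 0 i))
                                (dchart_inv a.1 (chart_inv a.1 y) (delta_mx 0 j)).
have -> : (fun y : 'rV[R]_(n + n) => local_metric a.1 (lsubmx y) i j : R) = h \o lsubmx.
  by apply/funext => y; rewrite mxE.
apply: differentiable_comp; first exact: dl.
rewrite lE; case: (metricP N) => _ _ sK; apply: smooth_on_open (sK a.1 _ _) _;
  exact: chart_ran_refl.
Qed.

(** Differentiates the quadratic polynomial [t |-> H(q, p + t g)]; the fibre derivative of [H] is
    the inverse Legendre transform. *)
Lemma dfun_hamiltonian_vertical a g :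
  dfun (hamiltonian N) a (row_mx 0 g) = pair g (a.2 *m invmx (K a.1)).
Proof.
pose e : 'rV[R]_(n + n) := row_mx 0 g.
pose c (t : R) := chart a a + t *: e.
pose k (t : R) := a.2 + t *: g.
have dc : is_diff (0 : R) c (fun t => t *: e).
  have := is_diffD (is_diff_cst (chart a a) 0) (is_diff_scalel 0 e).
  by congr is_diff_def; apply/funext => t; rewrite fctE add0r.
have dk : is_diff (0 : R) k (fun t => t *: g).
  have := is_diffD (is_diff_cst a.2 0) (is_diff_scalel 0 g).
  by congr is_diff_def; apply/funext => t; rewrite fctE add0r.
have dk' : is_diff (0 : R) (fun t => k t *m invmx (K a.1))
  (fun t => (t *: g) *m invmx (K a.1)).
  apply: (is_diff_comp dk (g := mulmxr (invmx (K a.1))) (dg := mulmxr (invmx (K a.1)))).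
  exact: is_diff_linear.
have dH : is_diff (c 0) (hamiltonian N \o chart_inv a)
  ('d (hamiltonian N \o chart_inv a) (chart a a)).
  by rewrite /c scale0r addr0; exact/differentiableP/differentiable_hamiltonian.
have H1 := is_diff_comp dc dH.
have H2 := is_diff_pair_rV dk dk'.
have H3 := is_diffD (is_diffZ 2^-1 H2) (is_diff_cst (potential N a.1) 0).
have ct t : chart_inv a (c t) = (a.1, k t) :> cotangent Q.
  rewrite /c cot_chart_refl /e scale_row_mx add_row_mx scaler0 addr0 -/(k t).
  rewrite cot_chart_invE row_mxKl row_mxKr chart_inv_refl; congr (_, _).
  by apply: pair_ext => w; rewrite pair_covector_dchart dchart_refl.
have E : 2^-1 *: (fun t => pair (k t) (k t *m invmx (K a.1))) + cst (potential N a.1) =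
    (hamiltonian N \o chart_inv a) \o c.
  apply/funext => t; transitivity (hamiltonian N (chart_inv a (c t))); last by [].
  by rewrite ct hamiltonianE /= [_ / 2]mulrC.
rewrite E in H3.
have := etrans (esym (diff_apply (1 : R) H1)) (diff_apply (1 : R) H3).
rewrite /= scale1r !fctE addr0 scale1r /k scale0r addr0 => {}H1.
apply: etrans H1 _; rewrite pair_invmx_metricC; move: (pair _ _) => x.
by rewrite -[LHS]/(2^-1 * (x + x)); lra.
Qed.

End Hamiltonian.

(** * Smoothness at a point *)

Section SmoothAt.
Variable R : realType.
Implicit Types V W : normedModType R.

(** Smoothness on some neighbourhood, rather than at the single point, composes without tracking
    domains. *)
Definition smooth_at V W (f : V -> W) (x : V) :=
  exists2 U : set V, open U /\ U x & smooth_on U f.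

Lemma smooth_on_at V W (U : set V) (f : V -> W) x :
  open U -> smooth_on U f -> U x -> smooth_at f x.
Proof. by move=> oU sf Ux; exists U. Qed.

Lemma smooth_at_on V W (U : set V) (f : V -> W) :
  (forall x, U x -> smooth_at f x) -> smooth_on U f.
Proof.
by move=> sf k; apply: Ck_local => x /sf[U' [_ U'x] sU']; exists U';
  [exact: U'x|exact: sU'].
Qed.

Lemma smooth_at_differentiable V W (f : V -> W) x : smooth_at f x -> differentiable f x.
Proof. by move=> [U [_ Ux] sf]; exact: smooth_on_open sf Ux. Qed.

Lemma smooth_at_near V W (f g : V -> W) x : {near x, f =1 g} -> smooth_at f x ->
  smooth_at g x.
Proof.
move=> fg [U [oU Ux] sf]; pose E : set V := [set y | f y = g y].
exists (U `&` interior E); first by split;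
  [apply: openI => //; exact: open_interior|split].
move=> k; apply: (@Ck_eq _ _ _ _ _ f).
- by apply: openI => //; exact: open_interior.
- by move=> y [_ /interior_subset].
- by apply: Ck_sub (sf k) => y [].
Qed.

Lemma smooth_at_linear p W (f : {linear 'rV[R]_p -> W}) x : smooth_at f x.
Proof. by exists setT; [split=> //; exact: openT|move=> k; exact: Ck_linear]. Qed.

Lemma smooth_at_cst V W (c : W) (x : V) : smooth_at (cst c) x.
Proof. by exists setT; [split=> //; exact: openT|move=> k; exact: Ck_cst]. Qed.

Lemma smooth_at_id p (x : 'rV[R]_p) : smooth_at id x.
Proof. exact: (smooth_at_linear idfun x). Qed.

Lemma open_Ck_preimage V W k (U : set V) (f : V -> W) (O : set W) :
  open U -> Ck k U f -> open O -> open (U `&` f @^-1` O).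
Proof.
move=> oU Cf oO; have cf : Ck 0 U f by elim: k Cf => // k IH /CkW.
rewrite openE => x [Ux Ox]; apply: filterI; first exact: open_nbhs_nbhs.
have := cf x Ux; apply; exact: open_nbhs_nbhs.
Qed.

Lemma smooth_at_comp_real V p (f : V -> 'rV[R]_p) (g : 'rV[R]_p -> R) x :
  smooth_at f x -> smooth_at g (f x) -> smooth_at (g \o f) x.
Proof.
move=> [U [oU Ux] sf] [B [oB Bx] sg]; have oUB := open_Ck_preimage oU (sf 0%N) oB.
exists (U `&` f @^-1` B) => // k; apply: (@Ck_comp_real _ _ _ _ _ B) => //.
- by move=> y [].
- by apply: Ck_sub (sf k) => y [].
Qed.

Lemma smooth_at_comp V p q (f : V -> 'rV[R]_p) (g : 'rV[R]_p -> 'rV[R]_q) x :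
  smooth_at f x -> smooth_at g (f x) -> smooth_at (g \o f) x.
Proof.
move=> [U [oU Ux] sf] [B [oB Bx] sg]; have oUB := open_Ck_preimage oU (sf 0%N) oB.
exists (U `&` f @^-1` B) => // k; apply: (@Ck_comp _ _ _ _ _ _ B) => //.
- by move=> y [].
- by apply: Ck_sub (sf k) => y [].
Qed.

Lemma smooth_at2 V W W' W'' (f : V -> W) (g : V -> W') (h : V -> W'') x :
  (forall k U, open U -> Ck k U f -> Ck k U g -> Ck k U h) ->
  smooth_at f x -> smooth_at g x -> smooth_at h x.
Proof.
move=> H [U [oU Ux] sf] [B [oB Bx] sg]; have oUB := openI oU oB.
exists (U `&` B) => // k; apply: H => //.
- by apply: Ck_sub (sf k) => y [].
- by apply: Ck_sub (sg k) => y [].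
Qed.

Lemma smooth_at_pair V p (f g : V -> 'rV[R]_p) x :
  smooth_at f x -> smooth_at g x -> smooth_at (fun y => pair (f y) (g y)) x.
Proof. by apply: smooth_at2 => k U; exact: Ck_pair. Qed.

Lemma smooth_at_row_mx V p q (f : V -> 'rV[R]_p) (g : V -> 'rV[R]_q) x :
  smooth_at f x -> smooth_at g x -> smooth_at (fun y => row_mx (f y) (g y)) x.
Proof. by apply: smooth_at2 => k U; exact: Ck_row_mx. Qed.

Lemma smooth_at_sum V W (I : Type) (s : seq I) (f : I -> V -> W) x :
  (forall i, smooth_at (f i) x) -> smooth_at (fun y => \sum_(i <- s) f i y) x.
Proof.
move=> sf; elim: s => [|i s IH].
  have -> : (fun y => \sum_(i <- [::]) f i y) = cst 0 by apply/funext => y;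
    rewrite big_nil.
  exact: smooth_at_cst.
have -> : (fun y => \sum_(j <- i :: s) f j y) = f i \+ (fun y => \sum_(j <- s) f j y).
  by apply/funext => y; rewrite big_cons.
by apply: smooth_at2 (sf i) IH => k U; exact: CkD.
Qed.

(** Expanding in both bases leaves sums of products of coordinates of [w] with partial derivatives
    of [F] along [f]. *)
Lemma smooth_at_diff V p q (F : 'rV[R]_p -> 'rV[R]_q) (f w : V -> 'rV[R]_p) x :
  smooth_at f x -> smooth_at w x -> smooth_at F (f x) ->
  smooth_at (fun y => 'd F (f y) (w y)) x.
Proof.
move=> sf sw [B [oB Bx] sF].
have sdF j : smooth_at (fun z => 'd F z (delta_mx 0 j)) (f x).
  by exists B => // k; have [_] := sF k.+1; apply.
have sdj j i : smooth_at (fun y => coordl i ('d F (f y) (delta_mx 0 j))) x.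
  apply: (smooth_at_comp_real (g := coordl i) (smooth_at_comp sf (sdF j))).
  exact: smooth_at_linear.
have swj j : smooth_at (fun y => coordl j (w y)) x.
  by apply: (smooth_at_comp_real (g := coordl j) sw); exact: smooth_at_linear.
have -> : (fun y => 'd F (f y) (w y)) = fun y => \sum_i (\sum_j
    coordl j (w y) * coordl i ('d F (f y) (delta_mx 0 j))) *: delta_mx 0 i.
  apply/funext => y; rewrite [LHS]row_sum_delta; apply: eq_bigr => i _; congr (_ *: _).
  rewrite [in LHS](linear_rV_sum ('d F (f y))) summxE; apply: eq_bigr => j _.
  exact: mxE.
apply: smooth_at_sum => i.
have : smooth_at (fun y => \sum_j coordl j (w y) * coordl i
  ('d F (f y) (delta_mx 0 j))) x.
  by apply: smooth_at_sum => j; apply: smooth_at2 (swj j) (sdj j i) => k U; exact: CkM.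
by move=> [U [oU Ux] sU]; exists U => // k; exact: Ck_scale.
Qed.

End SmoothAt.

(** * Cotangent lifts and generators *)

Section CotangentLift.
Variables (R : realType) (n : nat) (Q : manifold R n) (X : Q -> 'rV[R]_n).
Hypothesis smoothX : forall x, smooth_at (field_rep X x) (chart x x).
Implicit Types a : cotangent Q.

(** The fibrewise linear function on [T*Q] whose Hamiltonian vector field is the cotangent lift of
    [X]. *)
Definition momentum a : R := pair a.2 (X a.1).

Lemma momentum_chart a : momentum \o chart_inv a =
  fun y => pair (rsubmx y) ((field_rep X a.1 \o lsubmx) y).
Proof.
apply/funext => y.
exact: (pair_covector_dchart (rsubmx y) a.1 (chart_inv a.1 (lsubmx y)) _).
Qed.

Lemma smooth_at_field_lsubmx a :
  smooth_at (field_rep X a.1 \o (lsubmx : 'rV[R]_(n + n) -> 'rV[R]_n)) (chart a a).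
Proof.
apply: smooth_at_comp; first exact: (smooth_at_linear lsubmx).
by rewrite row_mxKl; exact: smoothX.
Qed.

Lemma smooth_at_momentum a : smooth_at (momentum \o chart_inv a) (chart a a).
Proof.
rewrite momentum_chart; apply: smooth_at_pair; last exact: smooth_at_field_lsubmx.
exact: (smooth_at_linear rsubmx).
Qed.

Lemma dfun_momentum_vertical a g : dfun momentum a (row_mx 0 g) = pair g (X a.1).
Proof.
have df := smooth_at_differentiable (smooth_at_field_lsubmx a).
have H := is_diff_pair_rV (is_diff_rsubmx (chart a a)) (differentiableP df).
rewrite /dfun momentum_chart; apply: etrans (diff_apply (row_mx 0 g) H) _.
have lE : lsubmx (chart a a) = chart a.1 a.1 by rewrite row_mxKl.
have dX : is_diff (lsubmx (chart a a)) (field_rep X a.1)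
  ('d (field_rep X a.1) (chart a.1 a.1)).
  by rewrite lE; exact/differentiableP/smooth_at_differentiable.
have Hl := is_diff_comp (is_diff_lsubmx (chart a a)) dX.
have -> : 'd (field_rep X a.1 \o (lsubmx : 'rV[R]_(n + n) -> 'rV[R]_n)) (chart a a)
  (row_mx 0 g) = 0.
  by apply: etrans (diff_apply (row_mx 0 g) Hl) _; rewrite /= row_mxKl linear0.
rewrite row_mxKr linear0 addr0 /= lE; apply: (congr1 (pair g)).
by rewrite /field_rep chart_inv_refl dchart_refl.
Qed.

Lemma cot_liftP a w : Omega a (cot_lift X a) w = dfun momentum a w.
Proof.
have [v vP] := Omega_nondegenerate a (dfun momentum a).
exact: (@xgetPex _ 0 [set v | forall w, Omega a v w = dfun momentum a w]
  (ex_intro _ v vP)).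
Qed.

(** On test vectors [(0, g)] the defining equation equates [g] on the base part of the lift with
    [g(X)]. *)
Lemma lsubmx_cot_lift a : lsubmx (cot_lift X a) = X a.1.
Proof.
apply: pair_ext => g; rewrite pairC (pairC (X _)) -dfun_momentum_vertical -cot_liftP.
by rewrite OmegaE row_mxKl row_mxKr linear0 subr0.
Qed.

End CotangentLift.

(** * Slices of functions of two variables *)

Section SmoothSlices.
Variable R : realType.

Lemma smooth_at_row_mxl p q (u : 'rV[R]_p) (v : 'rV[R]_q) :
  smooth_at (fun z => row_mx z v) u.
Proof. by apply: smooth_at_row_mx; [exact: smooth_at_id|exact: smooth_at_cst]. Qed.

Lemma smooth_at_row_mxr p q (u : 'rV[R]_p) (v : 'rV[R]_q) :
  smooth_at (fun z => row_mx u z) v.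
Proof. by apply: smooth_at_row_mx; [exact: smooth_at_cst|exact: smooth_at_id]. Qed.

Lemma is_diff_row_mxl p q (u : 'rV[R]_p) (v : 'rV[R]_q) :
  is_diff u (fun z => row_mx z v) (fun w => row_mx w 0).
Proof.
apply: DiffDef; first exact: smooth_at_differentiable (smooth_at_row_mxl u v).
apply/funext => w; apply: etrans
  (diff_row_mx w (ex_diff (is_diff_def := is_diff_id u)) (differentiable_cst v u)) _.
apply: (congr2 row_mx);
  [exact: diff_apply (is_diff_id u)|exact: diff_apply (is_diff_cst v u)].
Qed.

Lemma is_diff_row_mxr p q (u : 'rV[R]_p) (v : 'rV[R]_q) :
  is_diff v (fun z => row_mx u z) (fun w => row_mx 0 w).
Proof.
apply: DiffDef; first exact: smooth_at_differentiable (smooth_at_row_mxr u v).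
apply/funext => w; apply: etrans
  (diff_row_mx w (differentiable_cst u v) (ex_diff (is_diff_def := is_diff_id v))) _.
apply: (congr2 row_mx);
  [exact: diff_apply (is_diff_cst u v)|exact: diff_apply (is_diff_id v)].
Qed.

Lemma smooth_at_near_open (V W : normedModType R) (f : V -> W) (x : V) (U : set W) :
  smooth_at f x -> open U -> U (f x) -> \forall y \near x, U (f y).
Proof.
move=> /smooth_at_differentiable/differentiable_continuous cf oU Ux.
by apply: cf; exact: open_nbhs_nbhs.
Qed.

Lemma dchart_tmap m n (A : manifold R m) (B : manifold R n) (f : A -> B) x z v :
  differentiable_map f z -> chart_dom x (f z) ->
  dchart x (f z) (tmap f z v) = 'd (chart x \o f \o chart_inv z) (chart z z) v.
Proof.
move=> df xfz; have zz := chart_dom_refl (f z).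
exact: esym (diff_map_comp v (chart_inv_refl z) df (differentiable_transition zz xfz)).
Qed.

End SmoothSlices.

(** * The action in charts and its infinitesimal generators *)

Section Action.
Variables (R : realType) (n k : nat) (Q : manifold R n) (G : lie_group R k).
Variable act : G -> Q -> Q.
Hypothesis hact : free_proper_action act.
Local Notation e := (lone G).

Lemma act1 q : act e q = q.
Proof. by case: hact => -[]. Qed.

Lemma act_lmul g h q : act (lmul g h) q = act g (act h q).
Proof. by case: hact => -[]. Qed.

(** The target chart stays fixed at [act g x], so this is one function whose partial differentials
    express generators and tangent maps at all nearby points. *)
Definition action_rep (g : G) (x : Q) (y : 'rV[R]_(k + n)) : 'rV[R]_n :=
  chart (act g x) (act (chart_inv g (lsubmx y)) (chart_inv x (rsubmx y))).

Lemma action_repP g x : exists U : set 'rV[R]_(k + n),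
  [/\ open U, U (row_mx (chart g g) (chart x x)),
    forall y, U y -> [/\ chart_ran g (lsubmx y), chart_ran x (rsubmx y) &
      chart_dom (act g x) (act (chart_inv g (lsubmx y)) (chart_inv x (rsubmx y)))] &
    forall y, U y -> smooth_at (action_rep g x) y].
Proof.
case: hact => _ sa _ _; have [U [[oU Ux] Uran Udom sU]] := sa ((g, x) : prod_atlas G Q).
exists U; split; [exact: oU|exact: Ux| |].
  move=> y Uy; have [[g' x'] [/= gg' xx'] yE] := Uran y Uy.
  split; last exact: Udom.
    by exists g' => //; rewrite -yE row_mxKl.
  by exists x' => //; rewrite -yE row_mxKr.
by move=> y Uy; exact: smooth_on_at oU sU Uy.
Qed.


Lemma action_rep_row_mx g x u v : action_rep g x (row_mx u v) =
  chart (act g x) (act (chart_inv g u) (chart_inv x v)).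
Proof. by rewrite /action_rep row_mxKl row_mxKr. Qed.

Lemma act_orbit_differentiable g x : differentiable_map (fun h => act h x) g.
Proof.
have [U [oU Ux HU sU]] := action_repP g x.
have sl := smooth_at_row_mxl (chart g g) (chart x x).
split.
  have -> : chart (act g x) \o (fun h => act h x) \o chart_inv g =
      action_rep g x \o (fun z => row_mx z (chart x x)).
    by apply/funext => z; rewrite /= action_rep_row_mx chart_inv_refl.
  by apply/smooth_at_differentiable/smooth_at_comp => //; exact: sU.
apply: filterS (smooth_at_near_open sl oU Ux) => z /HU[_ _].
by rewrite row_mxKl row_mxKr chart_inv_refl => /chartK.
Qed.

Lemma act_differentiable g x : differentiable_map (act g) x.
Proof.
have [U [oU Ux HU sU]] := action_repP g x.
have sl := smooth_at_row_mxr (chart g g) (chart x x).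
split.
  have -> : chart (act g x) \o act g \o chart_inv x =
      action_rep g x \o (fun z => row_mx (chart g g) z).
    by apply/funext => z; rewrite /= action_rep_row_mx chart_inv_refl.
  by apply/smooth_at_differentiable/smooth_at_comp => //; exact: sU.
apply: filterS (smooth_at_near_open sl oU Ux) => z /HU[_ _].
by rewrite row_mxKl row_mxKr chart_inv_refl => /chartK.
Qed.

(** Moved from the chart at [z] to the chart at [x], the generator at [z] is the derivative of
    [action_rep e x] at [(e, z)] in the group direction [xi z]. *)
Lemma smooth_at_generator (xi : Q -> 'rV[R]_k) x : smooth_fun xi ->
  smooth_at (field_rep (section_generator act xi) x) (chart x x).
Proof.
move=> sxi; have [U [oU Ux HU sU]] := action_repP e x.
have sl := smooth_at_row_mxr (chart e e) (chart x x).
pose f y := 'd (action_rep e x) (row_mx (chart e e) y) (row_mx (xi (chart_inv x y)) 0).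
apply: (@smooth_at_near _ _ _ f); last first.
  apply: smooth_at_diff; [exact: sl| |exact: sU].
  apply: smooth_at_row_mx; last exact: smooth_at_cst.
  exact: smooth_on_at (@open_chart_ran _ _ Q x) (sxi x) (@chart_ran_refl _ _ Q x).
apply: filterS (smooth_at_near_open sl oU Ux) => y Uy.
have [_ yr zd] := HU _ Uy; rewrite row_mxKl row_mxKr chart_inv_refl in zd.
set z := chart_inv x y in zd *.
have xz : chart_dom x (act e z) by move: zd; rewrite !act1.
have E : chart x \o (fun h => act h z) \o chart_inv e = action_rep e x \o
  (fun u => row_mx u y).
  by apply/funext => u; rewrite /= action_rep_row_mx act1.
have H := is_diff_comp (is_diff_row_mxl (chart e e) y)
  (differentiableP (smooth_at_differentiable (sU _ Uy))).
have := dchart_tmap (xi z) (act_orbit_differentiable e z) xz; rewrite E act1 => H1.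
apply: esym; apply: etrans H1 _; exact: diff_apply H.
Qed.

End Action.

(** * The action on the constraint submanifold *)

Section CotangentAction.
Variables (R : realType) (n k : nat) (Q : manifold R n) (G : lie_group R k).
Variable act : G -> Q -> Q.
Hypothesis hact : free_proper_action act.
Local Notation e := (lone G).
Implicit Types (a : cotangent Q) (g : G) (q : Q).

Lemma smooth_map_at m p (A : atlas R m) (B : atlas R p) (f : A -> B) x : smooth_map f ->
  smooth_at (chart (f x) \o f \o chart_inv x) (chart x x) /\
  \forall u \near chart x x, chart_dom (f x) (f (chart_inv x u)).
Proof.
move=> /(_ x)[U [[oU Ux] _ HU sU]]; split; first exact: smooth_on_at oU sU Ux.
exact: open_near oU Ux HU.
Qed.

Lemma actK g q : act (linv g) (act g q) = q.
Proof. by rewrite -(act_lmul hact) lmulV (act1 hact). Qed.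

(** [linv e] fixes the point [q], so freeness identifies it with [e]. *)
Lemma linv1 q : linv e = e.
Proof. by case: hact => _ _ fr _; apply: (fr _ q); rewrite -{1}(act1 hact q) actK. Qed.

Lemma cot_act1 a : cot_act act e a = a.
Proof.
case: a => q p; rewrite /cot_act /=.
have actid : act (linv e) = id by apply/funext => x; rewrite (linv1 q) (act1 hact).
rewrite actid (act1 hact); congr (_, _); apply: pair_ext => v.
rewrite (covector_pairK p (tmap id q)); apply: (congr1 (pair p)).
exact: diff_transition_id (chart_dom_refl q).
Qed.

(** Since [g^-1] brings [g q] back to [q], its tangent map there ends in the fixed chart at [q]. It
    is thus a slice derivative of [action_rep e q], which makes its dependence on [g] tractable. *)
Lemma tmap_act_dchart_inv q (U : set 'rV[R]_(k + n)) g u :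
  (forall y, U y -> smooth_at (action_rep act e q) y) ->
  chart_dom e (linv g) -> chart_dom q (act g q) ->
  U (row_mx (chart e (linv g)) (chart q (act g q))) ->
  tmap (act (linv g)) (act g q) (dchart_inv q (act g q) u) =
  'd (action_rep act e q) (row_mx (chart e (linv g)) (chart q (act g q))) (row_mx 0 u).
Proof.
move=> sU eg qz Uy; set z := act g q in qz Uy *; set g' := linv g in eg Uy *.
have zz := chart_dom_refl z; have gz : act g' z = q by exact: actK.
have [dg' _] := act_differentiable hact g' z; rewrite gz in dg'.
have H := is_diff_comp (is_diff_row_mxr (chart e g') (chart q z))
  (differentiableP (smooth_at_differentiable (sU _ Uy))).
have E : (action_rep act e q) \o (fun v => row_mx (chart e g') v) =
    (chart q \o act g') \o chart_inv q.
  by apply/funext => v; rewrite /= action_rep_row_mx (act1 hact) chartK.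
rewrite E in H; apply: etrans _ (diff_apply u H); rewrite /tmap gz.
exact: esym (diff_transition_comp u qz zz dg').
Qed.

(** Read in the chart at [q], the covector at [g q] pairs [p] with the base derivative of the action
    at [(g^-1, g q)], and this point depends smoothly on [g] because inversion does. *)
Lemma differentiable_cot_act_orbit a :
  differentiable (fun u => chart a (cot_act act (chart_inv e u) a)) (chart e e) /\
  \forall u \near chart e e, chart_dom a.1 (act (chart_inv e u) a.1).
Proof.
case: a => q p; rewrite /=; set a : cotangent Q := (q, p).
have [U [oU Ux HU sU]] := action_repP hact e q.
have sl := smooth_at_row_mxl (chart e e) (chart q q).
have [sI dI] := smooth_map_at e (@linv_smooth _ _ G); rewrite (linv1 q) in sI dI.
pose Iv := chart e \o @linv _ _ G \o chart_inv e.
pose B u := chart q (act (chart_inv e u) q).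
have BE : B = action_rep act e q \o (fun u => row_mx u (chart q q)).
  by apply/funext => u; rewrite /= action_rep_row_mx (act1 hact) chart_inv_refl.
have sB : smooth_at B (chart e e) by rewrite BE; apply: smooth_at_comp => //; exact: sU.
have sIB : smooth_at (fun u => row_mx (Iv u) (B u)) (chart e e)
  by exact: smooth_at_row_mx.
have B0 : row_mx (Iv (chart e e)) (B (chart e e)) = row_mx (chart e e) (chart q q).
  by rewrite /Iv /B /= chart_inv_refl (linv1 q) (act1 hact).
have UIB : U (row_mx (Iv (chart e e)) (B (chart e e))) by rewrite B0.
have nU := smooth_at_near_open sl oU Ux.
have nIB := smooth_at_near_open sIB oU UIB.
have ndom : \forall u \near chart e e, chart_dom q (act (chart_inv e u) q).
  by apply: filterS nU => u /HU[_ _];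
    rewrite row_mxKl row_mxKr chart_inv_refl (act1 hact).
split; last exact: ndom.
pose F u := row_mx (B u) (\row_j pair p
  ('d (action_rep act e q) (row_mx (Iv u) (B u)) (row_mx 0 (delta_mx 0 j)))).
apply: (@near_differentiable _ _ _ F); last first.
  apply: differentiable_row_mx; first exact: smooth_at_differentiable sB.
  apply: differentiable_rV => j.
  have -> : (fun u => (\row_j pair p
      ('d (action_rep act e q) (row_mx (Iv u) (B u)) (row_mx 0 (delta_mx 0 j)))) 0 j :
        R) =
    fun u => pair p ('d (action_rep act e q) (row_mx (Iv u) (B u))
      (row_mx 0 (delta_mx 0 j))).
    by apply/funext => u; exact: mxE.
  apply: smooth_at_differentiable; apply: smooth_at_pair; first exact: smooth_at_cst.
  apply: smooth_at_diff; [exact: sIB|exact: smooth_at_cst|exact: sU].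
near=> u; have eg : chart_dom e (linv (chart_inv e u)) by near: u.
have qz : chart_dom q (act (chart_inv e u) q) by near: u.
have Uy : U (row_mx (Iv u) (B u)) by near: u.
rewrite /F; apply: (congr2 row_mx (erefl _)); apply/rowP => j.
rewrite [LHS]mxE [RHS]mxE.
rewrite (covector_pairK p (tmap (act (linv (chart_inv e u))) (act (chart_inv e u) q))).
apply: (congr1 (pair p)); exact: esym (tmap_act_dchart_inv (delta_mx 0 j) sU eg qz Uy).
Unshelve. all: by end_near. Qed.

End CotangentAction.

(** * The symmetry group acting on the constraint submanifold *)

Section SymmetricSystem.
Variables (R : realType) (n r k : nat) (Q : manifold R n).
Variables (N : nonholonomic_system r Q) (M : manifold R (n + r)).
Variable iota : M -> cotangent Q.
Hypothesis hM : is_constraint_submanifold N iota.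
Variables (G : lie_group R k) (act : G -> Q -> Q).
Hypothesis hsym : is_symmetry N act.
Local Notation K := (metric N).
Local Notation e := (lone G).

Lemma symmetry_action : free_proper_action act.
Proof. by case: hsym. Qed.

(** At zero velocity, invariance of the Lagrangian is invariance of the potential. The quadratic
    part is then invariant, and polarization gives the bilinear form. *)
Lemma metric_form_invariant g q v w :
  metric_form K (act g q) (tmap (act g) q v) (tmap (act g) q w) = metric_form K q v w.
Proof.
case: hsym => _ hL _; have H0 := hL g q 0.
have pot : potential N (act g q) = potential N q.
  move: H0; rewrite linear0 /lagrangian !metric_formE !linear0 mul0r !sub0r.
  by move/oppr_inj.
have Hd u : metric_form K (act g q) (tmap (act g) q u) (tmap (act g) q u) =
  metric_form K q u u.
  by have := hL g q u; rewrite /lagrangian pot => /addIr /mulIf; apply;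
    rewrite invr_eq0 pnatr_eq0.
have pol x (u u' : 'rV[R]_n) : metric_form K x (u + u') (u + u') =
    metric_form K x u u + metric_form K x u' u' + 2 * metric_form K x u u'.
  rewrite !metric_formE !linearD /= !pairDl -!metric_formE (metric_formC N x u' u);
    ring.
have := Hd (v + w); rewrite linearD /= !pol !Hd => /addrI /mulfI; apply.
by rewrite pnatr_eq0.
Qed.

(** An isometry carries [kappa^flat(v)] to [kappa^flat] of the transported vector, which stays in
    [D]. *)
Lemma cot_act_range g a : range iota a -> range iota (cot_act act g a).
Proof.
move=> /(range_iotaP hM)[v vD pE]; apply/(range_iotaP hM) => /=.
(* Invariance of [D] is applied to [g^-1] at [g q], which presents [v] as the image of a vector [v']
   of [D] there. *)
case: hsym => hact _ /(_ (linv g) (act g a.1)); rewrite (actK hact) => hD.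
move: vD; rewrite -hD => /memv_imgP[v' v'D vE]; exists v' => //.
have {}vE : v = tmap (act (linv g)) (act g a.1) v'.
  by rewrite vE; exact: (lfunE (tmap (act (linv g)) (act g a.1))).
apply: pair_ext => w; rewrite (covector_pairK _ (tmap (act (linv g)) (act g a.1))).
rewrite -metric_formE -(metric_form_invariant (linv g)) (actK hact) -vE metric_formE.
by rewrite pE.
Qed.

Lemma iota_actM g m : iota (actM iota act g m) = cot_act act g (iota m).
Proof.
have [m' _ E] : range iota (cot_act act g (iota m)) by apply: cot_act_range; exists m.
exact: (@xgetPex _ m [set m' | iota m' = cot_act act g (iota m)] (ex_intro _ m' E)).
Qed.

Lemma actM1 m : actM iota act e m = m.
Proof.
have [_ ii _ _] := iota_emb hM; apply: ii.
by rewrite iota_actM (cot_act1 symmetry_action).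
Qed.

(** [actM] is defined by choice; its orbit map [gam] is differentiable as the lift of the orbit map
    in [T*Q], whose base component is the orbit in [Q]. *)
Lemma lsubmx_generator_actM m eta :
  lsubmx (tmap iota m (generator (actM iota act) eta m)) = generator act eta (iota m).1.
Proof.
set a := iota m; have hact := symmetry_action.
have [dc ndom] := differentiable_cot_act_orbit hact a.
pose c u := chart a (cot_act act (chart_inv e u) a).
pose gam u := actM iota act (chart_inv e u) m.
have gamE : gam (chart e e) = m by rewrite /gam chart_inv_refl actM1.
have Hc : \forall s \near chart e e,
  iota (gam s) = chart_inv (iota (gam (chart e e))) (c s) /\
     chart (iota (gam (chart e e))) (iota (gam s)) = c s.
  apply: filterS ndom => u ud; rewrite gamE /gam iota_actM; split; last by [].
  exact: esym (cot_chartK (a := a) (b := cot_act act (chart_inv e u) a) ud).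
have [_ _ H] := differentiable_embedding_lift (@cot_chartK _ _ Q) (iota_emb hM) Hc dc.
have {}H : 'd c (chart e e) eta = tmap iota m (generator (actM iota act) eta m).
  by rewrite H gamE /generator /tmap actM1.
rewrite -H.
have E1 := diff_linear_comp (lsubmx : {linear 'rV[R]_(n + n) -> 'rV[R]_n}) eta dc.
apply: etrans (esym E1) _; rewrite /generator /tmap (act1 hact).
have -> : (lsubmx : 'rV[R]_(n + n) ->
  'rV[R]_n) \o (fun u => chart a (cot_act act (chart_inv e u) a)) =
    chart a.1 \o (fun g => act g a.1) \o chart_inv e; last by [].
by apply/funext => u; exact: row_mxKl.
Qed.

End SymmetricSystem.

(** * Gauge momenta *)

Section GaugeMomenta.
Variables (R : realType) (n r : nat) (Q : manifold R n).
Variables (N : nonholonomic_system r Q) (M : manifold R (n + r)).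
Variable iota : M -> cotangent Q.
Hypothesis hM : is_constraint_submanifold N iota.
Local Notation D := (constr N).

Lemma dfun_iota (f : cotangent Q -> R) m u :
  differentiable (f \o chart_inv (iota m)) (chart (iota m) (iota m)) ->
  dfun (f \o iota) m u = dfun f (iota m) (tmap iota m u).
Proof.
by move=> df; exact: diff_map_comp u (chart_inv_refl m) (iota_differentiable hM m) df.
Qed.

Lemma CM_projC m v : lsubmx v \in D (iota m).1 -> CM N iota m (projC N iota m v).
Proof. by move=> /(projCP hM)[]. Qed.

(** The defect has zero base part. Every [b] in [D] is the base part of some vector of [C], and
    orthogonality to that vector reads [g(b) = 0]. *)
Lemma projC_defect m v : lsubmx v \in D (iota m).1 ->
  exists2 g, v = tmap iota m (projC N iota m v) + row_mx 0 g &
    forall b, b \in D (iota m).1 -> pair g b = 0.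
Proof.
move=> vD; have [_ H] := projCP hM vD; set u := projC N iota m v in H *.
have E : lsubmx (v - tmap iota m u) = 0.
  by rewrite (linearB lsubmx) /= /u (lsubmx_projC hM vD) subrr.
exists (rsubmx (v - tmap iota m u)); first by rewrite -E hsubmxK addrC subrK.
move=> b bD; have [w wE] := tangent_horizontal hM m b.
have wC : CM N iota m w by rewrite (CME hM) wE.
have := H w wC; rewrite OmegaE E linear0 sub0r wE => /eqP.
by rewrite oppr_eq0 => /eqP.
Qed.

(* dH(0, g) = g(v) with v in D the velocity of the point of M, and g
   annihilates D. *)
Lemma dfun_HM_projC m v : lsubmx v \in D (iota m).1 ->
  dfun (HM N iota) m (projC N iota m v) = dfun (hamiltonian N) (iota m) v.
Proof.
move=> vD; have [g vE gD] := projC_defect vD.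
apply: etrans (dfun_iota _ (differentiable_hamiltonian N (iota m))) _.
rewrite [in RHS]vE linearD /= dfun_hamiltonian_vertical.
have [w wD ->] := iota_flat hM m.
by rewrite flatK gD// addr0.
Qed.

Variable X : Q -> 'rV[R]_n.
Hypothesis smoothX : forall x, smooth_at (field_rep X x) (chart x x).
Hypothesis XD : forall q, X q \in D q.

Lemma lsubmx_cot_lift_mem m : lsubmx (cot_lift X (iota m)) \in D (iota m).1.
Proof. by rewrite lsubmx_cot_lift. Qed.

Lemma Theta_cot_lift m : Theta (iota m) (cot_lift X (iota m)) = momentum X (iota m).
Proof. by rewrite ThetaE lsubmx_cot_lift. Qed.

Lemma ThetaM_projC m :
  ThetaM iota m (projC N iota m (cot_lift X (iota m))) = momentum X (iota m).
Proof.
rewrite /ThetaM /pullback1 ThetaE (lsubmx_projC hM (lsubmx_cot_lift_mem m)).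
by rewrite lsubmx_cot_lift.
Qed.

(** [smooth_fun] concerns the whole range of a chart, whereas [iota] and the momentum are controlled
    at chart centres. Each point [m] is therefore reached through the transition to its own
    chart. *)
Lemma smooth_momentum_iota : smooth_fun (momentum X \o iota).
Proof.
move=> x; apply: smooth_at_on => y yr; set m := chart_inv x y.
have xm : chart_dom x m by exact: chart_inv_dom.
have mm := chart_dom_refl m.
have yE : chart x m = y by exact: chart_invK.
have [smi _ _ _] := iota_emb hM; have [si di] := smooth_map_at m smi.
pose T := chart m \o chart_inv x; pose I := chart (iota m) \o iota \o chart_inv m.
have Ty : T y = chart m m by [].
have Im : I (chart m m) = chart (iota m) (iota m) by rewrite /I /= chart_inv_refl.
have sT : smooth_at T y.
  apply: smooth_on_at (@open_overlap _ _ M x m) (@smooth_transition _ _ M x m) _.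
  by move: (overlap_chart xm mm); rewrite yE.
have sIT : smooth_at (I \o T) y by apply: smooth_at_comp; [exact: sT|rewrite Ty].
have : smooth_at ((momentum X \o chart_inv (iota m)) \o (I \o T)) y.
  by apply: smooth_at_comp_real; [exact: sIT|rewrite /= Ty Im;
    exact: smooth_at_momentum].
apply: smooth_at_near.
have nT : \forall z \near y, chart_dom (iota m) (iota (chart_inv m (T z))).
  have cT := differentiable_continuous (smooth_at_differentiable sT).
  exact: (cT [set u | chart_dom (iota m) (iota (chart_inv m u))] di).
have no : \forall z \near y, overlap x m z by rewrite -yE; exact: near_overlap.
near=> z; have /overlapP[zr zm] : overlap x m z by near: z.
have : chart_dom (iota m) (iota (chart_inv m (T z))) by near: z.
have -> : chart_inv m (T z) = chart_inv x z by exact: chartK.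
move=> zd; have E : I (T z) = chart (iota m) (iota (chart_inv x z)).
  by apply: (congr1 (fun p => chart (iota m) (iota p))); exact: chartK.
apply: (congr1 (momentum X)); rewrite /= E; exact: cot_chartK.
Unshelve. all: by end_near. Qed.

Lemma first_integral_momentum :
  (forall m, dfun (hamiltonian N) (iota m) (cot_lift X (iota m)) = 0) ->
  first_integral N iota (momentum X \o iota).
Proof.
move=> HX; split=> [|m]; first exact: smooth_momentum_iota.
(* Without a solution of the defining equation the chosen vector is the default 0, where the
   differential vanishes; otherwise [u] is a solution. *)
rewrite /Xnh /the; case: xgetP => [u _ [uC uP]|_]; last exact: linear0.
rewrite dfun_iota; last exact/smooth_at_differentiable/smooth_at_momentum.
rewrite -cot_liftP//; set a := iota m; set Y := cot_lift X a.
have YD : lsubmx Y \in D (iota m).1 by exact: lsubmx_cot_lift_mem.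
have [g YE gD] := projC_defect YD.
(* The equation of the dynamics is tested on the projection of [Y]; its right side is
   [dH(Y) = 0]. *)
have := uP _ (CM_projC YD); rewrite dfun_HM_projC// HX /OmegaM /pullback2.
have lY := lsubmx_projC hM YD; have rY :
  rsubmx Y = rsubmx (tmap iota m (projC N iota m Y)) + g.
  by rewrite {1}YE linearD /= row_mxKr.
(* Replacing [Y] by its projection costs [g] on the base part of [u], which lies in [D], where [g]
   vanishes. *)
rewrite !OmegaE lY rY pairDl (gD (lsubmx (tmap iota m u))); last by rewrite -(CME hM).
by rewrite addr0 => /eqP; rewrite subr_eq0 => /eqP ->; rewrite subrr.
Qed.

End GaugeMomenta.

Theorem corollary3p5 (R : realType) (n r s k : nat) (Q : manifold R n)
    (N : nonholonomic_system r Q) (G : lie_group R k) (act : G -> Q -> Q)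
    (hsym : is_symmetry N act)
    (hS : is_distribution s (distrS N act))
    (M : manifold R (n + r)) (iota : M -> cotangent Q)
    (hM : is_constraint_submanifold N iota)
    (xi : Q -> 'rV[R]_k) (hxi : is_section_gS N act xi) :
  (horizontal_gauge_symmetry N iota act xi <->
     forall m, dfun (HM N iota) m (section_M_lift N iota act xi m) = 0) /\
  (horizontal_gauge_symmetry N iota act xi ->
     first_integral N iota (gauge_momentum iota act xi) /\
     forall m, gauge_momentum iota act xi m =
                 ThetaM iota m (section_M_lift N iota act xi m) /\
               ThetaM iota m (section_M_lift N iota act xi m) =
                 Jnh iota act m (xi (tauM iota m))).
Proof.
have [hact _ _] := hsym; have [sxi xiS] := hxi.
pose X := section_generator act xi.
have sX x : smooth_at (field_rep X x) (chart x x) by exact: smooth_at_generator.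
have XD q : X q \in constr N q by have := xiS q; rewrite /gS /= memv_cap => /andP[].
have YD m := lsubmx_cot_lift_mem iota sX XD m.
have HE m : dfun (HM N iota) m (section_M_lift N iota act xi m) =
    dfun (hamiltonian N) (iota m) (section_cot_lift act xi (iota m)).
  exact: (dfun_HM_projC hM (YD m)).
have JE : gauge_momentum iota act xi = momentum X \o iota.
  by apply/funext => m; exact: (Theta_cot_lift iota sX m).
split; first by split=> [[_ H] m|H]; [rewrite HE|split=> // m; rewrite -HE].
move=> [_ H]; split; first by rewrite JE; exact: first_integral_momentum.
move=> m; have TE := ThetaM_projC hM sX XD m; split; first by rewrite JE; exact: esym TE.
(* [Theta] sees only base parts, and the generator on [M] lies over the generator on [Q]. *)
apply: etrans TE _; rewrite /Jnh /ThetaM /pullback1 ThetaE.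
by rewrite (lsubmx_generator_actM hM hsym).
Qed.
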